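(* Let $\dot x = Ax + \sum_{i=1}^m B_i u_i$, $y_i = C_i x$ ($i \in \{1,\dots,m\}$) be an $n$-dimensional continuous-time $m$-channel linear system with $u_i\in\mathbb{R}^{p_i}$, $y_i\in\mathbb{R}^{q_i}$, which is jointly controllable and jointly observable, with $B_i\neq 0$, $C_i\neq 0$ for all $i$, and whose neighbor graph is strongly connected. Let $F_i\in\mathbb{R}^{p_i\times n}$, $i\in\{1,\dots,m\}$, be any feedback matrices, let $q\in\{1,\dots,m\}$, and let $\Lambda$ be any symmetric set (closed under complex conjugation, counted with multiplicity) of $mn+m-1$ complex numbers. Then there exist real matrices $K_i\in\mathbb{R}^{n\times q_i}$, $H_{ij}\in\mathbb{R}^{n\times n}$ ($i\in\{1,\dots,m\}$, $j\in\mathcal{N}_i$), $\bar A\in\mathbb{R}^{(m-1)\times(m-1)}$, $\bar C\in\mathbb{R}^{n\times(m-1)}$, $\bar K\in\mathbb{R}^{(m-1)\times q_q}$, $\bar H_j\in\mathbb{R}^{(m-1)\times n}$ ($j\in\mathcal{N}_q$) such that the spectrum of the $(mn+m-1)$-dimensional linear system $$\dot e_i = (A+K_iC_i)e_i + \sum_{j\in\mathcal{N}_i}H_{ij}(e_i-e_j) + \delta_{iq}\bar C z + \sum_{j=1}^m B_jF_j(e_i-e_j),\quad i\in\{1,\dots,m\},$$ $$\dot z = \bar A z + \bar K C_q e_q + \sum_{j\in\mathcal{N}_q}\bar H_j(e_q-e_j),$$ with state $(e_1,\dots,e_m,z)\in(\mathbb{R}^n)^m\times\mathbb{R}^{m-1}$,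 is $\Lambda$.
   Context: Jointly controllable means $(A,[B_1\ \cdots\ B_m])$ is controllable; jointly observable means $(\mathrm{column}\{C_1,\dots,C_m\},A)$ is observable. The neighbor graph is a directed graph on vertices $\{1,\dots,m\}$ with an arc from $j$ to $i$ iff agent $j$ is a neighbor of agent $i$; $\mathcal{N}_i$ is the set of neighbors of $i$ including $i$. Strongly connected: a directed path exists between every ordered pair of vertices. $\delta_{iq}$ is the Kronecker delta. *)

(* Defs.v *)
From HB Require Import structures.
From mathcomp Require Import all_boot all_order all_algebra.
From mathcomp Require Import reals.
From mathcomp Require Import complex.
Set Implicit Arguments. Unset Strict Implicit. Unset Printing Implicit Defensive.
Import Order.TTheory GRing.Theory Num.Theory.
Local Open Scope ring_scope.

Definition controllable (R : fieldType) (n p : nat) (A : 'M[R]_n) (B : 'M[R]_(n, p)) :=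
  \rank (\mxrow_(k < n) (A ^+ k *m B)) == n.

Definition observable (R : fieldType) (n q : nat) (C : 'M[R]_(q, n)) (A : 'M[R]_n) :=
  \rank (\mxcol_(k < n) (C *m A ^+ k)) == n.

Definition jointly_controllable (R : fieldType) (n m : nat) (p : 'I_m -> nat)
  (A : 'M[R]_n) (B : forall i : 'I_m, 'M[R]_(n, p i)) :=
  controllable A (\mxrow_(i < m) B i).

Definition jointly_observable (R : fieldType) (n m : nat) (q : 'I_m -> nat)
  (A : 'M[R]_n) (C : forall i : 'I_m, 'M[R]_(q i, n)) :=
  observable (\mxcol_(i < m) C i) A.

(* Neighbor graph: N i is the set of neighbors of agent i (containing i);
   there is an arc from j to i iff j \in N i. *)
Definition neighbor_arc (m : nat) (N : 'I_m -> {set 'I_m}) : rel 'I_m :=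
  fun j i => j \in N i.

Definition strongly_connected (m : nat) (N : 'I_m -> {set 'I_m}) :=
  forall i j : 'I_m, connect (neighbor_arc N) i j.

Definition symmetric_spectrum (R : rcfType) (L : seq R[i]) :=
  perm_eq (map conjc L) L.

Definition spectrum_is (R : rcfType) (k : nat) (M : 'M[R]_k) (L : seq R[i]) :=
  map_poly (fun x : R => (x%:C)%C) (char_poly M) = \prod_(l <- L) ('X - l%:P).

(* Block (i,k) (both e-blocks) of the closed-loop matrix: coefficient of e_k
   in  de_i/dt = (A+K_i C_i) e_i + sum_{j in N_i} H_ij (e_i - e_j)
                 + delta_iq Cbar z + sum_j B_j F_j (e_i - e_j). *)
Definition ee_block (R : rcfType) (n m : nat) (p q : 'I_m -> nat)
  (N : 'I_m -> {set 'I_m}) (A : 'M[R]_n)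
  (B : forall i : 'I_m, 'M[R]_(n, p i)) (C : forall i : 'I_m, 'M[R]_(q i, n))
  (F : forall i : 'I_m, 'M[R]_(p i, n)) (K : forall i : 'I_m, 'M[R]_(n, q i))
  (H : 'I_m -> 'I_m -> 'M[R]_n) (i k : 'I_m) : 'M[R]_n :=
  (i == k)%:R *: (A + K i *m C i + \sum_(j in N i) H i j
                  + \sum_(j < m) B j *m F j)
  - (k \in N i)%:R *: H i k - B k *m F k.

(* Coefficient of e_k in  dz/dt = Abar z + Kbar C_q e_q + sum_{j in N_q} Hbar_j (e_q - e_j). *)
Definition ze_block (R : rcfType) (n m : nat) (q : 'I_m -> nat)
  (N : 'I_m -> {set 'I_m}) (C : forall i : 'I_m, 'M[R]_(q i, n)) (qq : 'I_m)
  (Kbar : 'M[R]_(m.-1, q qq)) (Hbar : 'I_m -> 'M[R]_(m.-1, n)) (k : 'I_m)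
  : 'M[R]_(m.-1, n) :=
  (k == qq)%:R *: (Kbar *m C qq + \sum_(j in N qq) Hbar j)
  - (k \in N qq)%:R *: Hbar k.

Definition closed_loop_matrix (R : rcfType) (n m : nat) (p q : 'I_m -> nat)
  (N : 'I_m -> {set 'I_m}) (A : 'M[R]_n)
  (B : forall i : 'I_m, 'M[R]_(n, p i)) (C : forall i : 'I_m, 'M[R]_(q i, n))
  (F : forall i : 'I_m, 'M[R]_(p i, n)) (qq : 'I_m)
  (K : forall i : 'I_m, 'M[R]_(n, q i)) (H : 'I_m -> 'I_m -> 'M[R]_n)
  (Abar : 'M[R]_(m.-1)) (Cbar : 'M[R]_(n, m.-1)) (Kbar : 'M[R]_(m.-1, q qq))
  (Hbar : 'I_m -> 'M[R]_(m.-1, n))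
  : 'M[R]_(\sum_(i < m) n + m.-1) :=
  block_mx
    (@mxblock R m m (fun _ => n) (fun _ => n) (fun i k => ee_block N A B C F K H i k))
    (@mxcol R m (fun _ => n) m.-1 (fun i => (i == qq)%:R *: Cbar))
    (@mxrow R m (fun _ => n) m.-1 (fun k => ze_block N C Kbar Hbar k))
    Abar.

(* Main.v *)
(* Call a matrix admissible when it arises from the open-loop error system by
   static feedback at each agent [i] from its measurements: [C_i e_i] and the
   differences [e_i - e_j] with its neighbors.  It suffices to find an admissible
   [M] such that, with [b] the input of agent [q] and [w] a single linear
   combination of its measurements,
   - [b, M b, ..., M^(m-1) b] spans the state space, and
   - [w, w M, w M^2, ...] spans the dual space.
   Indeed, if [r] is monic of degree [m - 1] and [P] is a vector polynomial of
   degree at most [m - 1], the compensator [r(d/dt) z = w e], [u = P(d/dt) z] at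
   [q] yields the characteristic polynomial
   [chi_M r - w adj(X - M) b P], and by the two spanning conditions this takes
   every monic value of degree [m n + m - 1].

   Both conditions say that the rank of a matrix depending polynomially on the
   parameters is maximal, so they can be achieved separately and over the complex
   numbers.  The first one is achieved by a large Laplacian feedback along a
   spanning tree with root [q].  For the second one, the measurements of all agents
   jointly observe the open loop, and generic feedback at one agent at a time
   makes the measurements of that agent superfluous until only [q] remains; then
   feedback at [q] is chosen so that a single combination [w] suffices. *)
Require Import Defs.
From HB Require Import structures.
From mathcomp Require Import all_boot all_order all_algebra.
From mathcomp Require Import reals.
From mathcomp Require Import complex.
From mathcomp Require Import zify ring lra.
Set Implicit Arguments. Unset Strict Implicit. Unset Printing Implicit Defensive.
Import Order.TTheory GRing.Theory Num.Theory.
Local Open Scope ring_scope.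

(** * Polynomial families of matrices and Krylov spaces *)

(** Natural numbers are distinct in characteristic zero, so they cannot all be roots. A natural
    parameter is at once real and complex. *)
Lemma nat_nonroot (F : numFieldType) (d : {poly F}) :
  d != 0 -> exists j : nat, ~~ root d j%:R.
Proof.
move=> d0; have [/existsP[j dj]|] := boolP [exists j : 'I_(size d), ~~ root d j%:R].
  by exists j.
rewrite negb_exists => /forallP droots.
pose rs : seq F := [seq j%:R | j <- iota 0 (size d)].
have rs_root : all (root d) rs.
  apply/allP => _ /mapP[j + ->]; rewrite mem_iota add0n => /= jd.
  by have /negbNE := droots (Ordinal jd).
have rs_uniq : uniq rs.
  by rewrite map_inj_uniq ?iota_uniq // => i j /eqP; rewrite eqr_nat => /eqP.
by have := max_poly_roots d0 rs_root rs_uniq; rewrite size_map size_iota ltnn.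
Qed.

Lemma mxcol_subP (F : fieldType) (k : nat) (p : 'I_k -> nat) (n r : nat)
    (A : forall i, 'M[F]_(p i, n)) (B : 'M[F]_(r, n)) :
  reflect (forall i, (A i <= B)%MS) (\mxcol_i A i <= B)%MS.
Proof.
apply: (iffP idP) => [/submxP[D AD] i|AB].
  by rewrite -[A i](mxcolK A) AD -submxcol_mul submxMl.
by apply/row_subP => i; rewrite row_mxcol; apply: submx_trans (row_sub _ _) (AB _).
Qed.

Lemma sub_mxcol (F : fieldType) (k : nat) (p : 'I_k -> nat) (n : nat)
    (A : forall i, 'M[F]_(p i, n)) i : (A i <= \mxcol_i A i)%MS.
Proof. by have /mxcol_subP := submx_refl (\mxcol_i A i); apply. Qed.

Lemma mxcol_eq0P (F : fieldType) (k : nat) (p : 'I_k -> nat) (n r : nat)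
    (A : forall i, 'M[F]_(p i, n)) (x : 'M[F]_(n, r)) :
  \mxcol_i A i *m x = 0 <-> forall i, A i *m x = 0.
Proof.
rewrite mxcol_mul; split=> [A0 i|A0].
  by rewrite -[LHS](mxcolK (fun i => A i *m x)) A0 submxcol0.
by rewrite -[RHS]mxcol0; apply: eq_mxcol => i; rewrite A0.
Qed.

Section PolynomialFamilies.
Variable F : fieldType.

(** Multipliers [L] and [P] chosen at [t0] reduce the family there to the identity of size [r]; [d]
    is the determinant of the reduced family, so its value at [t0] is 1. *)
Lemma rank_poly_family a b (Q : 'M[{poly F}]_(a, b)) (r : nat) (t0 : F) :
  (r <= \rank (map_mx (horner_eval t0) Q))%N ->
  exists2 d : {poly F}, ~~ root d t0 &
    forall t, ~~ root d t -> (r <= \rank (map_mx (horner_eval t) Q))%N.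
Proof.
move=> rQ; set Q0 := map_mx _ Q in rQ.
pose L : 'M[F]_(r, a) := pid_mx r *m invmx (col_ebase Q0).
pose P : 'M[F]_(b, r) := invmx (row_ebase Q0) *m pid_mx r.
have LQP : L *m Q0 *m P = 1%:M.
  rewrite -[in LHS](mulmx_ebase Q0) /L /P !mulmxA mulmxKV ?col_ebase_unit //.
  rewrite mulmxK ?row_ebase_unit // !mul_pid_mx.
  have := rank_leq_row Q0; have := rank_leq_col Q0.
  set s := (X in pid_mx X) => rb ra; have -> : s = r by rewrite /s; lia.
  by rewrite pid_mx_1.
pose d := \det (map_mx polyC L *m Q *m map_mx polyC P).
have dE t : d.[t] = \det (L *m map_mx (horner_eval t) Q *m P).
  rewrite -[d.[t]]/(horner_eval t d) -det_map_mx !map_mxM.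
  have evalC (k l : nat) (A : 'M[F]_(k, l)) :
      map_mx (horner_eval t) (map_mx polyC A) = A.
    by apply/matrixP => i j; rewrite !mxE /horner_eval hornerC.
  by rewrite !evalC.
exists d; first by rewrite rootE dE -/Q0 LQP det1 oner_eq0.
move=> t; rewrite rootE dE => dt.
have : \rank (L *m map_mx (horner_eval t) Q *m P) = r.
  by apply: mxrank_unit; rewrite unitmxE unitfE.
move=> {1}<-; exact: leq_trans (mxrankM_maxl _ _) (mxrankM_maxr _ _).
Qed.

(* Controllability of [(M, b)] is treated as observability of [(b^T, M^T)]. *)
Definition krylov r n k (c : 'M[F]_(r, n)) (M : 'M[F]_n) :=
  \mxcol_(i < k) (c *m M ^+ i).

Lemma map_mxX (R S : nzRingType) (f : {rmorphism R -> S}) n (M : 'M[R]_n) k :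
  map_mx f (M ^+ k) = map_mx f M ^+ k.
Proof. exact: rmorphXn. Qed.

Lemma krylov_generic r n k (c0 c1 : 'M[F]_(r, n)) (M0 M1 : 'M[F]_n) s t0 :
  (s <= \rank (krylov k (c0 + t0 *: c1) (M0 + t0 *: M1)))%N ->
  exists2 d : {poly F}, ~~ root d t0 &
    forall t, ~~ root d t ->
      (s <= \rank (krylov k (c0 + t *: c1) (M0 + t *: M1)))%N.
Proof.
pose cp : 'M[{poly F}]_(r, n) := map_mx polyC c0 + 'X *: map_mx polyC c1.
pose Mp : 'M[{poly F}]_n := map_mx polyC M0 + 'X *: map_mx polyC M1.
pose Q := \mxcol_(i < k) (cp *m Mp ^+ i).
have lineE (a b : nat) (A B : 'M[F]_(a, b)) t :
    map_mx (horner_eval t) (map_mx polyC A + 'X *: map_mx polyC B) = A + t *: B.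
  by apply/matrixP => i j; rewrite !mxE /horner_eval !hornerE.
have QE t : map_mx (horner_eval t) Q = krylov k (c0 + t *: c1) (M0 + t *: M1).
  have stepE i : map_mx (horner_eval t) (cp *m Mp ^+ i) =
      (c0 + t *: c1) *m (M0 + t *: M1) ^+ i.
    by rewrite map_mxM map_mxX !lineE.
  apply/matrixP => a b.
  rewrite [LHS]mxE [X in horner_eval _ X]mxE [RHS]mxE -stepE [RHS]mxE.
  by congr (horner_eval t _); rewrite ?mxE.
rewrite -QE => /rank_poly_family[d d0 dP]; exists d => // t /dP.
by rewrite QE.
Qed.

End PolynomialFamilies.

Section Krylov.
Variables (F : fieldType) (n : nat).

Lemma expmx_sum (M : 'M[F]_n) :
  exists a : 'I_n -> F, M ^+ n = \sum_(i < n) a i *: M ^+ i.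
Proof.
case: n M => [|n'] M; first by exists (fun=> 0); apply/matrixP => -[].
exists (fun i => - (char_poly M)`_i).
have := Cayley_Hamilton M; rewrite -[X in horner_mx _ X]coefK size_char_poly poly_def.
rewrite rmorph_sum big_ord_recr /=.
have /monicP := char_poly_monic M; rewrite lead_coefE size_char_poly /= => ->.
rewrite scale1r rmorphXn /= horner_mx_X => /(canRL (addKr _)) ->.
rewrite addr0 -sumrN; apply: eq_bigr => i _.
by rewrite linearZ /= rmorphXn /= horner_mx_X scaleNr.
Qed.

Variables (r : nat) (c : 'M[F]_(r, n)) (M : 'M[F]_n).

(** Only the last block leaves the list of generators, and Cayley-Hamilton brings it back. *)
Lemma krylov_stable : (krylov n c M *m M <= krylov n c M)%MS.
Proof.
rewrite mxcol_mul; apply/mxcol_subP => i; rewrite -mulmxA.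
have -> : M ^+ i *m M = M ^+ i.+1 by rewrite exprSr.
have [lt_in|] := ltnP i.+1 n; first exact: (sub_mxcol _ (Ordinal lt_in)).
move=> le_ni; have -> : i.+1 = n by apply/eqP; rewrite eqn_leq ltn_ord.
have [a ->] := expmx_sum M; rewrite mulmx_sumr; apply: summx_sub => j _.
by rewrite -scalemxAr scalemx_sub // (sub_mxcol (fun i : 'I_n => c *m M ^+ i)).
Qed.

Lemma sub_krylov : (c <= krylov n c M)%MS.
Proof.
have [n0|n0] := posnP n.
  rewrite (_ : c = 0) ?sub0mx //; apply/matrixP => i j.
  by case/eqP: (lt0n_neq0 (leq_ltn_trans (leq0n j) (ltn_ord j))).
by have := sub_mxcol (fun i : 'I_n => c *m M ^+ i) (Ordinal n0); rewrite mulmx1.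
Qed.

Lemma krylov_min k s (V : 'M[F]_(s, n)) :
  (c <= V)%MS -> (V *m M <= V)%MS -> (krylov k c M <= V)%MS.
Proof.
move=> cV VM; apply/mxcol_subP => i; elim: (i : nat) => [|j IH].
  by rewrite mulmx1.
by rewrite exprSr mulmxA (submx_trans (submxMr _ IH)).
Qed.

End Krylov.

(** * Observability tested on eigenvectors *)

Section Popov.
Variable F : numClosedFieldType.

(* The Popov-Belevitch-Hautus form of observability. *)
Definition observes n r (c : 'M[F]_(r, n)) (M : 'M[F]_n) :=
  forall (l : F) (x : 'cV[F]_n), M *m x = l *: x -> c *m x = 0 -> x = 0.

Lemma stable_eigenvector n s (V : 'M[F]_(s, n)) (M : 'M[F]_n) :
  (V *m M <= V)%MS -> V != 0 ->
  exists l, exists2 u : 'rV_n, (u <= V)%MS /\ u != 0 & u *m M = l *: u.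
Proof.
move=> VM V0; have rV : (0 < \rank V)%N by rewrite lt0n mxrank_eq0.
have := @eigenvalue_closed F _ (restrictmx V M) rV.
case=> l /eigenvalueP[v vM v0]; exists l.
exists (v *m row_base V).
  rewrite mulmx_sub ?eq_row_base //.
  by rewrite mulmx_free_eq0 ?row_base_free.
rewrite scalemxAl -vM /conjmx -[in RHS]mulmxA mulmxKpV ?mulmxA //.
by rewrite stablemx_row_base.
Qed.

(** The annihilator of the Krylov space is stable, so it contains an eigenvector; [c] kills it
    because the rows of [c] lie in that space. *)
Lemma unobservable_mode n r (c : 'M[F]_(r, n)) (M : 'M[F]_n) :
  (\rank (krylov n c M) < n)%N ->
  exists l, exists x : 'cV_n, [/\ M *m x = l *: x, c *m x = 0 & x != 0].
Proof.
move=> rK; pose V := kermx (krylov n c M)^T.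
have V0 : V != 0 by rewrite -mxrank_eq0 mxrank_ker mxrank_tr subn_eq0 -ltnNge.
have VM : (V *m M^T <= V)%MS.
  have /submxP[D KM] := krylov_stable c M.
  rewrite sub_kermx -mulmxA -trmx_mul KM trmx_mul mulmxA.
  by rewrite mulmx_ker mul0mx.
have [l [u [uV u0] uM]] := stable_eigenvector VM V0.
exists l, u^T; split; last by rewrite trmx_eq0.
  by rewrite -[M]trmxK -trmx_mul uM linearZ.
have /submxP[D cK] := sub_krylov c M.
rewrite cK -mulmxA -[krylov _ _ _]trmxK -trmx_mul.
by move/sub_kermxP: uV => ->; rewrite trmx0 mulmx0.
Qed.

Lemma krylov_observes n r k (c : 'M[F]_(r, n)) (M : 'M[F]_n) :
  (n <= \rank (krylov k c M))%N -> observes c M.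
Proof.
move=> rK l x Mx cx; have Kx : krylov k c M *m x = 0.
  apply/mxcol_eq0P => i; rewrite -mulmxA.
  suff -> : M ^+ i *m x = l ^+ i *: x by rewrite -scalemxAr cx scaler0.
  elim: (i : nat) => [|j IH]; first by rewrite expr0 scale1r mul1mx.
  by rewrite exprSr -mulmxA Mx -scalemxAr IH scalerA exprSr mulrC.
have Kf : row_full (krylov k c M) by rewrite /row_full eqn_leq rank_leq_col.
by rewrite -[x]mul1mx -(mulVpmx Kf) -mulmxA Kx mulmx0.
Qed.

Lemma observesP n r (c : 'M[F]_(r, n)) (M : 'M[F]_n) :
  observes c M <-> (n <= \rank (krylov n c M))%N.
Proof.
split=> [obs|]; last exact: krylov_observes.
rewrite leqNgt; apply/negP => /unobservable_mode[l [x [Mx cx]]].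
by rewrite (obs l x) ?eqxx.
Qed.

End Popov.

(** * Observability by a single output *)

Section SingleOutput.
Variable F : numClosedFieldType.

Lemma krylov_mulr n r k (c : 'M[F]_(r, n)) (M N : 'M[F]_n) :
  N *m M = M *m N -> krylov k (c *m N) M = krylov k c M *m N.
Proof.
move=> NM; rewrite /krylov mxcol_mul; apply: eq_mxcol => i.
rewrite -!mulmxA; congr (_ *m _).
elim: (i : nat) => [|j IH]; first by rewrite mulmx1 mul1mx.
by rewrite exprS mulmxA NM -[LHS]mulmxA IH mulmxA.
Qed.

(** Modulo the image of [M - l], each generator is [l] times the preceding one. Hence [M - l] has
    corank at most one on the Krylov space of a single row. *)
Lemma krylov_sub_shift n k (w : 'rV[F]_n) (M : 'M[F]_n) l :
  (krylov k w M <= w + krylov k w M *m (M - l%:M))%MS.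
Proof.
apply/mxcol_subP => i; rewrite /krylov mxcol_mul.
have [j] := ubnP (i : nat); elim: j => // j IH in i *; rewrite ltnS.
case: i => -[|i] /= ltik; first by rewrite mulmx1 addsmxSl.
move=> le_ij; have ltik' := ltnW ltik.
have -> : w *m M ^+ i.+1 = w *m M ^+ i *m (M - l%:M) + l *: (w *m M ^+ i).
  by rewrite mulmxBr mul_mx_scalar subrK exprSr mulmxA.
rewrite addmx_sub ?scalemx_sub ?(IH (Ordinal ltik')) //.
apply: submx_trans (addsmxSr _ _).
exact: (sub_mxcol (fun i : 'I_k => w *m M ^+ i *m (M - l%:M)) (Ordinal ltik')).
Qed.

(* [M - l] is injective on the Krylov space of [g c], hence its image of the Krylov
   space of a small perturbation [w] of [g c] has at least the same dimension; but
   this image annihilates [x], so it does not contain [w] when [w x != 0]. *)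
Lemma krylov_raise_nonmodal n r (M : 'M[F]_n) (c : 'M[F]_(r, n)) (g : 'rV[F]_r)
    l (x : 'cV[F]_n) (V := krylov n (g *m c) M) :
  M *m x = l *: x -> g *m c *m x = 0 -> c *m x != 0 ->
  (V :&: eigenspace M l)%MS == 0 ->
  exists h : 'rV[F]_r, (\rank V < \rank (krylov n (h *m c) M))%N.
Proof.
move=> Mx gcx cx /eqP V0.
have [j cxj] : exists j, (c *m x) j 0 != 0.
  apply/existsP; rewrite -negb_forall; apply: contraNN cx => /forallP cx0.
  by apply/eqP/colP => j; rewrite (eqP (cx0 j)) mxE.
pose e : 'rV[F]_r := delta_mx 0 j; pose N := M - l%:M.
have NM : N *m M = M *m N by rewrite mulmxBl mulmxBr scalar_mxC.
have Nx : N *m x = 0 by rewrite mulmxBl Mx mul_scalar_mx subrr.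
have rV : \rank (V *m N) = \rank V by rewrite -[RHS](mxrank_mul_ker V N) V0 mxrank0 addn0.
have [|d d0 dP] := @krylov_generic F 1 n n (g *m c *m N) (e *m c *m N) M 0 (\rank V) 0.
  by rewrite !scale0r !addr0 krylov_mulr // rV.
(* The factor ['X] excludes [t = 0], for which [w x] would vanish. *)
have dX0 : d * 'X != 0.
  by rewrite mulf_neq0 ?polyX_eq0 //; apply: contraNneq d0 => ->; rewrite root0.
have [t0n] := nat_nonroot dX0; set t : F := t0n%:R.
rewrite rootM rootX negb_or => /andP[/dP rt t0].
exists (g + t *: e); set w := _ *m c.
have wE : w *m N = g *m c *m N + t *: (e *m c *m N).
  by rewrite /w !mulmxDl -!scalemxAl.
rewrite scaler0 addr0 -wE krylov_mulr // in rt.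
apply: leq_ltn_trans rt _; rewrite ltnNge; apply/negP => rK.
have KN : (krylov n w M *m N <= krylov n w M)%MS.
  rewrite mulmxBr addmx_sub ?krylov_stable // eqmx_opp mul_mx_scalar.
  exact: scalemx_sub.
have /submxP[D wD] : (w <= krylov n w M *m N)%MS.
  apply: submx_trans (sub_krylov w M) _.
  by rewrite -(geq_leqif (mxrank_leqif_sup KN)).
have : w *m x = 0 by rewrite wD -!mulmxA Nx !mulmx0.
rewrite /w mulmxDl -scalemxAl mulmxDl gcx add0r -scalemxAl -mulmxA.
move/matrixP/(_ 0 0); rewrite mxE -rowE !mxE => /eqP; rewrite mulf_eq0 (negPf t0) /=.
by move: cxj; rewrite mxE => /negPf ->.
Qed.

Lemma observes_feedback n r (M : 'M[F]_n) (c : 'M[F]_(r, n)) (D : 'M[F]_(n, r)) :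
  observes c M -> observes c (M + D *m c).
Proof.
move=> obs l x; rewrite mulmxDl -mulmxA => + cx; rewrite cx mulmx0 addr0 => Mx.
exact: obs Mx cx.
Qed.

(* When [l] is an eigenvalue of [M] on the Krylov space [V] of [w = g c], the
   feedback [b xi w] preserves [V] and [M x = l x], and removes [l] from the spectrum
   on [V] as soon as [xi] is visible from the left eigenvector. *)
Lemma krylov_raise n p r (M : 'M[F]_n) (b : 'M[F]_(n, p)) (c : 'M[F]_(r, n))
    (g : 'rV[F]_r) :
  observes b^T M^T -> observes c M -> (\rank (krylov n (g *m c) M) < n)%N ->
  exists (G : 'M[F]_(p, r)) (h : 'rV[F]_r),
    (\rank (krylov n (g *m c) M)
      < \rank (krylov n (h *m c) (M + b *m G *m c)))%N.
Proof.
move=> ctr obs rV; have [l [x [Mx wx x0]]] := unobservable_mode rV.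
have cx0 : c *m x != 0 by apply: contraNneq x0 => cx; apply/eqP/(obs l).
set w := g *m c in rV wx *; set V := krylov n w M in rV *.
have [V0|] := boolP ((V :&: eigenspace M l)%MS == 0).
  have [h hP] := krylov_raise_nonmodal Mx wx cx0 V0.
  by exists 0, h; rewrite mulmx0 mul0mx addr0.
case/rowV0Pn => u; rewrite sub_capmx => /andP[uV uE] u0.
have uM := eigenspaceP uE.
have ub0 : u *m b != 0.
  apply: contraNneq u0 => ub; rewrite -trmx_eq0; apply/eqP/(ctr l).
    by rewrite -trmx_mul uM linearZ.
  by rewrite -trmx_mul ub trmx0.
have [j ubj] : exists j, (u *m b) 0 j != 0.
  apply/existsP; rewrite -negb_forall; apply: contraNN ub0 => /forallP ub0.
  by apply/eqP/rowP => j; rewrite (eqP (ub0 j)) mxE.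
pose xi : 'cV[F]_p := delta_mx j 0; pose M' := M + b *m (xi *m g) *m c.
have M'E : M' = M + b *m xi *m w by rewrite /M' /w !mulmxA.
have M'x : M' *m x = l *: x.
  by rewrite M'E mulmxDl -!mulmxA [g *m _]mulmxA -/w wx !mulmx0 addr0.
pose V' := krylov n w M'.
have V'V : (V' <= V)%MS.
  apply: krylov_min; rewrite ?sub_krylov // M'E mulmxDr addmx_sub ?krylov_stable //.
  by rewrite mulmxA mulmx_sub ?sub_krylov.
have VV' : (V <= V')%MS.
  have -> : V = krylov n w (M' - b *m xi *m w) by rewrite M'E addrK.
  apply: krylov_min; rewrite ?sub_krylov // mulmxBr addmx_sub ?krylov_stable //.
  by rewrite eqmx_opp mulmxA mulmx_sub ?sub_krylov.
have rVV' : \rank V' = \rank V by apply/eqP; rewrite eqn_leq !mxrankS.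
have rcap : (\rank (V :&: eigenspace M l)%MS <= 1)%N.
  rewrite -(leq_add2l (\rank (V *m (M - l%:M)))) mxrank_mul_ker addnC.
  apply: leq_trans (mxrankS (krylov_sub_shift n w M l)) _.
  by apply: leq_trans (mxrank_adds_leqif _ _) _; rewrite leq_add2r rank_leq_row.
have V'0 : (V' :&: eigenspace M' l)%MS == 0.
  apply/rowV0P => v; rewrite sub_capmx => /andP[vV' /eigenspaceP vM'].
  have vV := submx_trans vV' V'V; apply/eqP.
  pose s := (v *m b *m xi) 0 0.
  have vN : v *m (M - l%:M) = - s *: w.
    have vbx : v *m b *m xi = s%:M by rewrite [LHS]mx11_scalar.
    rewrite mulmxBr mul_mx_scalar -vM' M'E mulmxDr !mulmxA vbx mul_scalar_mx.
    by rewrite -scalemxAl -/w opprD addrA subrr add0r scaleNr.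
  (* If [s = 0], then [v] is a multiple of [u], which [xi] sees, so [v = 0]. Otherwise [w] lies in
     the image of [V] under [M - l], which is then all of [V], against the eigenvector [u]. *)
  have [s0|s0] := eqVneq s 0.
    have vu : (v <= u)%MS.
      have vcap : (v <= V :&: eigenspace M l)%MS.
        by rewrite sub_capmx vV sub_kermx vN s0 oppr0 scale0r eqxx.
      apply: submx_trans vcap _.
      have ucap : (u <= V :&: eigenspace M l)%MS by rewrite sub_capmx uV.
      by rewrite -(geq_leqif (mxrank_leqif_sup ucap)) rank_rV u0.
    have /sub_rVP[a va] := vu.
    move: s0; rewrite /s va -!scalemxAl mxE -colE mxE => /eqP.
    by rewrite mulf_eq0 (negPf ubj) orbF => /eqP ->; rewrite scale0r.
  have wN : (w <= V *m (M - l%:M))%MS.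
    have -> : w = - s^-1 *: (v *m (M - l%:M)).
      by rewrite vN scalerA mulrNN mulVf // scale1r.
    by rewrite scalemx_sub ?submxMr.
  have VN : (V <= V *m (M - l%:M))%MS.
    apply: submx_trans (krylov_sub_shift n w M l) _.
    by rewrite addsmx_sub wN submx_refl.
  have := mxrankS VN; rewrite -[X in (X <= _)%N](mxrank_mul_ker V (M - l%:M)).
  rewrite -[X in (_ <= X)%N]addn0 leq_add2l leqn0 mxrank_eq0 => /eqP cap0.
  suff : (u <= (0 : 'M[F]_n))%MS by rewrite submx0 (negPf u0).
  by rewrite -cap0 sub_capmx uV.
have [h hP] := krylov_raise_nonmodal M'x wx cx0 V'0.
by exists (xi *m g), h; rewrite -rVV'.
Qed.

(** Feedback from [c] through [b] preserves both hypotheses, so the Krylov dimension can be raised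
    repeatedly while the feedbacks add up. *)
Lemma single_output n p r (M : 'M[F]_n) (b : 'M[F]_(n, p)) (c : 'M[F]_(r, n)) :
  observes b^T M^T -> observes c M ->
  exists (G : 'M[F]_(p, r)) (g : 'rV[F]_r), observes (g *m c) (M + b *m G *m c).
Proof.
move=> ctr obs.
suff [G [g Gg]] : exists (G : 'M[F]_(p, r)) (g : 'rV[F]_r),
    (n <= \rank (krylov n (g *m c) (M + b *m G *m c)))%N.
  by exists G, g; apply/observesP.
suff raise k : (k <= n)%N -> exists (G : 'M[F]_(p, r)) (g : 'rV[F]_r),
    (k <= \rank (krylov n (g *m c) (M + b *m G *m c)))%N by exact: raise.
elim: k => [_|k IH kn]; first by exists 0, 0.
have [G [g]] := IH (ltnW kn); rewrite leq_eqVlt => /predU1P[rk|]; last by exists G, g.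
have [||| H [h]] := @krylov_raise n p r (M + b *m G *m c) b c g.
- by rewrite linearD /= !trmx_mul mulmxA; apply: observes_feedback.
- exact: observes_feedback.
- by rewrite -rk.
by rewrite -rk -addrA -mulmxDl -mulmxDr; exists (G + H), h.
Qed.

End SingleOutput.

(** * Admissible networks *)

Section Reachability.
Variables (m : nat) (e : rel 'I_m).

Lemma connect_entering (T : {set 'I_m}) q :
  (forall i, connect e i q) -> q \in T -> T != setT ->
  exists k i, [/\ k \notin T, i \in T & e k i].
Proof.
move=> conn qT; rewrite -subTset => /subsetPn[k0 _ k0T].
case/connectP: (conn k0) => p; elim: p k0 k0T => [|k p IH] k0 k0T /=.
  by move=> _ qk; rewrite -qk qT in k0T.
case/andP=> ek0 pk qE; have [kT|kT] := boolP (k \in T); first by exists k0, k.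
exact: IH kT pk qE.
Qed.

Lemma breadth_first_rank q : (forall i, connect e q i) ->
  exists2 rk : 'I_m -> nat, injective rk &
    forall i, i != q -> exists2 j, e j i & (rk j < rk i)%N.
Proof.
move=> conn.
pose grow (S : {set 'I_m}) := S :|: [set i | [exists j in S, e j i]].
pose layer k := iter k grow [set q].
have path_layer p x k : x \in layer k -> path e x p ->
    exists k', last x p \in layer k'.
  elim: p x k => [|y p IH] x k xk /=; first by exists k.
  case/andP=> exy; apply: (IH y k.+1); rewrite /layer iterS !inE.
  by apply/orP; right; apply/existsP; exists x; rewrite -/(layer k) xk.
have in_layer i : exists k, i \in layer k.
  by have /connectP[p pP ->] := conn i; apply: (path_layer p q 0%N); rewrite ?inE.
pose d i := ex_minn (in_layer i).
(* Layers are spaced by [m], so adding the index separates vertices of one layer without reordering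
   the layers. *)
exists (fun i => d i * m + i)%N => [i j dij|i iq].
  apply/val_inj; move: (congr1 (modn^~ m) dij) => /=.
  by rewrite !modnMDl !modn_small.
rewrite {2}/d; case: ex_minnP => -[|k]; first by rewrite inE (negPf iq).
rewrite {1}/layer iterS -/(layer k) => + mink; rewrite !inE => /orP[/mink|].
  by rewrite ltnn.
case/existsP=> j /andP[jk eji]; exists j => //.
have : (d j <= k)%N by rewrite /d; case: ex_minnP => ? _; apply.
have := ltn_ord j; nia.
Qed.

End Reachability.

(** * A weighted tree Laplacian controlled from its root *)

Section Leader.
Variables (F : numClosedFieldType) (m : nat) (nb : 'I_m -> {set 'I_m}) (q : 'I_m).
Hypothesis conn : forall i, connect (fun j i => j \in nb i) q i.

Definition tree_laplacian (h : 'I_m -> F) (par : 'I_m -> 'I_m) : 'M[F]_m :=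
  \matrix_(i, j) (h i * ((i == j)%:R - (par i == j)%:R)).

(* The weights decrease along the tree, so that a left eigenvector of the
   Laplacian which vanishes at the root has, up to scaling, nonnegative
   entries; its eigenequation then forces it to vanish on the children of
   every vertex where it vanishes. *)
Lemma leader_laplacian : exists (h : 'I_m -> F) (par : 'I_m -> 'I_m),
  [/\ forall i, i != q -> par i \in nb i, h q = 0 &
     observes (delta_mx 0 q : 'rV_m) (tree_laplacian h par)^T].
Proof.
have [rk rk_inj rkP] := breadth_first_rank conn.
(* The default is reached at most at the root, whose row is zero because [h q = 0]. *)
pose par i := odflt q [pick j | (j \in nb i) && (rk j < rk i)%N].
have parP i : i != q -> par i \in nb i /\ (rk (par i) < rk i)%N.
  move=> iq; rewrite /par; case: pickP => [j /andP[]//|no].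
  by have [j jn jr] := rkP i iq; have := no j; rewrite jn jr.
pose S := (\max_i rk i).+1.
have rkS i : (rk i < S)%N by rewrite ltnS leq_bigmax.
pose h i : F := if i == q then 0 else (S - rk i)%:R.
have h_gt0 i : i != q -> 0 < h i.
  by move=> iq; rewrite /h (negPf iq) ltr0n subn_gt0.
have h_ge0 i : 0 <= h i by rewrite /h; case: eqP => // _; apply: ler0n.
exists h, par; split; [by move=> i /parP[]|by rewrite /h eqxx|].
move=> l x Lx xq; pose w i := x i 0.
have wq : w q = 0 by move/matrixP/(_ 0 0): xq; rewrite -rowE !mxE.
have wL j : (h j - l) * w j = \sum_(i | par i == j) h i * w i.
  move/matrixP/(_ j 0): Lx; rewrite !mxE => Lx.
  rewrite mulrBl -[l * _]Lx [RHS]big_mkcond /=.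
  rewrite (eq_bigr (fun i => (if i == j then h i * w i else 0)
      - (if par i == j then h i * w i else 0))); last first.
    by move=> i _; rewrite !mxE -/(w i); do 2!case: eqP => _ /=; ring.
  by rewrite sumrB -big_mkcond big_pred1_eq opprB addrCA subrr addr0.
have [/forallP w0|] := boolP [forall i, w i == 0].
  by apply/colP => i; rewrite mxE; apply/eqP/w0.
rewrite negb_forall => /existsP[k0 wk0]; exfalso.
(* At the vertex [k] of largest rank with [w k != 0], the children contribute zero, so the
   eigenvalue is [h k]; dividing by [w k] then normalizes the eigenvector. *)
case: (@arg_maxnP _ k0 (fun i => w i != 0) rk wk0) => k wk maxk.
have kq : k != q by apply: contraNneq wk => ->; rewrite wq.
have w_big i : (rk k < rk i)%N -> w i = 0.
  by move=> ki; apply/eqP/negPn/negP => /maxk /=; rewrite leqNgt ki.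
have child_w i j : par i == j -> i != q -> (rk j < rk i)%N.
  by move=> /eqP <- /parP[].
have lk : l = h k.
  apply/eqP; rewrite eq_sym -subr_eq0 -(mulIr_eq0 _ (mulIf wk)) wL big1 // => i ik.
  have [->|iq] := eqVneq i q; first by rewrite /h eqxx mul0r.
  by rewrite w_big ?mulr0 // (child_w i).
pose y i := w i / w k.
have yL j : (h j - h k) * y j = \sum_(i | par i == j) h i * y i.
  by rewrite mulrA -lk wL mulr_suml; apply: eq_bigr => i _; rewrite mulrA.
have y_ge0 j : 0 <= y j.
  have [s] := ubnP (S - rk j)%N; elim: s => // s IH in j *; rewrite ltnS => js.
  have [->|jq] := eqVneq j q; first by rewrite /y wq mul0r.
  have [/w_big wj|jk|/rk_inj <-] := ltngtP (rk k) (rk j).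
  - by rewrite /y wj mul0r.
  - have hjk : 0 < h j - h k.
      rewrite subr_gt0 /h (negPf kq) (negPf jq) ltr_nat ltn_sub2l //.
    rewrite -(pmulr_rge0 _ hjk) yL sumr_ge0 // => i ij.
    have [->|iq] := eqVneq i q; first by rewrite /h eqxx mul0r.
    rewrite mulr_ge0 // IH // (leq_trans _ js) // ltn_sub2l //.
    exact: child_w ij iq.
  - by rewrite /y divff // ler01.
have y0 j : y j = 0.
  have [s] := ubnP (rk j); elim: s => // s IH in j *; rewrite ltnS => js.
  have [->|jq] := eqVneq j q; first by rewrite /y wq mul0r.
  have [_ pj] := parP j jq.
  have /eqP := yL (par j); rewrite (IH (par j)) ?(leq_trans pj) // mulr0 eq_sym.
  rewrite psumr_eq0 => [|i _]; last by rewrite mulr_ge0.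
  move/allP/(_ j (mem_index_enum j)); rewrite eqxx /= mulf_eq0.
  by rewrite (gt_eqF (h_gt0 j jq)) => /eqP.
by move: (y0 k); rewrite /y divff // => /eqP; rewrite oner_eq0.
Qed.
End Leader.

(** * Multipliers preserving finitely many ranks *)

Section RankPreservation.
Variable F : numClosedFieldType.

Lemma rank_line a b (X Y : 'M[F]_(a, b)) r t0 :
  (r <= \rank (X + t0 *: Y)%R)%N ->
  exists2 d : {poly F}, ~~ root d t0 &
    forall t, ~~ root d t -> (r <= \rank (X + t *: Y)%R)%N.
Proof.
pose Q := map_mx polyC X + 'X *: map_mx polyC Y.
have QE t : map_mx (horner_eval t) Q = X + t *: Y.
  by apply/matrixP => i j; rewrite !mxE /horner_eval !hornerE.
by rewrite -QE => /rank_poly_family[d d0 dP]; exists d => // t /dP; rewrite QE.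
Qed.

Lemma rank_preserving_generic n s k (ls : seq F) (Z : F -> 'M[F]_(s, k))
    (G H : 'M[F]_(n, s)) :
  (forall l, l \in ls -> (\rank (Z l) <= \rank (G *m Z l))%N) ->
  exists2 d : {poly F}, ~~ root d 0 &
    forall t, ~~ root d t ->
      forall l, l \in ls -> (\rank (Z l) <= \rank ((G + t *: H) *m Z l))%N.
Proof.
elim: ls => [|l ls IH] rG.
  by exists 1 => [|t _ l]; rewrite ?root1 ?in_nil.
have [l' l'ls|d d0 dP] := IH; first by rewrite rG // inE l'ls orbT.
have [|d' d'0 d'P] := @rank_line _ _ (G *m Z l) (H *m Z l) (\rank (Z l)) 0.
  by rewrite scale0r addr0 rG ?mem_head.
exists (d * d') => [|t]; rewrite rootM negb_or; first by rewrite d0.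
case/andP=> dt d't l'; rewrite inE => /predU1P[->|]; last exact: dP.
by rewrite mulmxDl -scalemxAl; apply: d'P.
Qed.

(** The values [l] are added one at a time: on the line from a multiplier good for the earlier
    values to one good for [l], a generic point is good for all. *)
Lemma rank_preserving_mul n s k (ls : seq F) (Z : F -> 'M[F]_(s, k)) :
  (forall l, (\rank (Z l) <= n)%N) ->
  exists G : 'M[F]_(n, s),
    forall l, l \in ls -> (\rank (Z l) <= \rank (G *m Z l))%N.
Proof.
move=> rZ; elim: ls => [|l ls [G GP]]; first by exists 0.
pose H : 'M[F]_(n, s) := pid_mx (\rank (Z l)) *m invmx (col_ebase (Z l)).
have rH : (\rank (Z l) <= \rank (H *m Z l))%N.
  rewrite -[X in H *m X]mulmx_ebase /H !mulmxA mulmxKV ?col_ebase_unit //.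
  rewrite mxrankMfree ?row_free_unit ?row_ebase_unit // mul_pid_mx.
  have := rank_leq_row (Z l); have := rank_leq_col (Z l); have := rZ l.
  set r := \rank (Z l); rewrite minnn => rn rk rs.
  by rewrite (minn_idPr rs) rank_pid_mx.
have [d d0 dP] := rank_preserving_generic (H - G) GP.
have [|d' d'1 d'P] := @rank_line _ _ (G *m Z l) ((H - G) *m Z l) (\rank (Z l)) 1.
  by rewrite scale1r -mulmxDl addrC subrK.
have dd0 : d * d' != 0.
  by rewrite mulf_neq0 //; apply/eqP => dE; [move: d0|move: d'1]; rewrite dE root0.
have [j] := nat_nonroot dd0; set t : F := j%:R.
rewrite rootM negb_or => /andP[dt d't]; exists (G + t *: (H - G)) => l'.
rewrite inE => /predU1P[->|]; last exact: dP.
by rewrite mulmxDl -scalemxAl; apply: d'P.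
Qed.

End RankPreservation.

(* [M] is obtained from [A0] by static feedback at each agent [i], acting on the
   block of rows [E i], from the measurements [c i]. *)
Definition admissible_for (K : fieldType) n m N (E : 'I_m -> 'M[K]_(n, N))
    (s : 'I_m -> nat) (c : forall i, 'M[K]_(s i, N)) (A0 M : 'M[K]_N) :=
  forall i, (E i *m (M - A0) <= c i)%MS.

Section StaticFeedback.
Variables (K : fieldType) (n m N : nat) (E : 'I_m -> 'M[K]_(n, N)).
Hypothesis E_orth : forall i j, E i *m (E j)^T = (i == j)%:R%:M.

Lemma block_off i j : i != j -> E i *m (E j)^T = 0.
Proof.
by move=> ij; rewrite E_orth (negPf ij); apply/matrixP=> a b; rewrite !mxE mul0rn.
Qed.

Lemma block_self i : E i *m (E i)^T = 1%:M. Proof. by rewrite E_orth eqxx. Qed.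

Variables (s : 'I_m -> nat) (c : forall i, 'M[K]_(s i, N)) (A0 : 'M[K]_N).

Lemma admissible_feedback M k (G : 'M[K]_(n, s k)) :
  admissible_for E c A0 M -> admissible_for E c A0 (M + (E k)^T *m G *m c k).
Proof.
move=> adm i; rewrite addrAC mulmxDr addmx_sub ?adm // !mulmxA.
have [->|ik] := eqVneq i k; last by rewrite block_off // !mul0mx sub0mx.
by rewrite submxMl.
Qed.

End StaticFeedback.

(** * Controlling and observing a network from one agent *)

Section Network.
Variables (F : numClosedFieldType) (n m N : nat) (nb : 'I_m -> {set 'I_m}).
Variables (E : 'I_m -> 'M[F]_(n, N)) (s : 'I_m -> nat).
Variables (c : forall i, 'M[F]_(s i, N)) (A0 : 'M[F]_N).

Hypothesis E_orth : forall i j, E i *m (E j)^T = (i == j)%:R%:M.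
Hypothesis E_total : \sum_i (E i)^T *m E i = 1%:M.
Hypothesis c_diff : forall i j, j \in nb i -> (E i - E j <= c i)%MS.
Hypothesis A0_diff : forall i j (x : 'cV[F]_N),
  E i *m x = E j *m x -> E i *m A0 *m x = E j *m A0 *m x.
Hypothesis joint : forall l (x : 'cV[F]_N),
  A0 *m x = l *: x -> (forall i, c i *m x = 0) -> x = 0.
Hypothesis conn : strongly_connected nb.

Local Notation admissible := (admissible_for E c A0).

Lemma admissible_line M1 M2 t :
  admissible M1 -> admissible M2 -> admissible (M1 + t *: (M2 - M1)).
Proof.
move=> adm1 adm2 i.
have -> : M1 + t *: (M2 - M1) - A0 = (M1 - A0) + t *: ((M2 - A0) - (M1 - A0)).
  by rewrite opprB addrA subrK addrAC.
rewrite mulmxDr addmx_sub ?adm1 // -scalemxAr scalemx_sub // mulmxBr.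
by rewrite addmx_sub ?adm2 // eqmx_opp adm1.
Qed.

(** Each rank condition holds at one end of an admissible line, hence both hold at a generic point
    of it. *)
Lemma admissible_both r1 r2 k1 k2 (o1 : 'M[F]_(r1, N)) (o2 : 'M[F]_(r2, N)) M1 M2 :
  admissible M1 -> (N <= \rank (krylov k1 o1 M1))%N ->
  admissible M2 -> (N <= \rank (krylov k2 o2 M2^T))%N ->
  exists M, [/\ admissible M, (N <= \rank (krylov k1 o1 M))%N &
    (N <= \rank (krylov k2 o2 M^T))%N].
Proof.
move=> adm1 r1N adm2 r2N.
have [|d1 d10 d1P] := @krylov_generic F _ _ k1 o1 0 M1 (M2 - M1) N 0.
  by rewrite scaler0 scale0r !addr0.
have [|d2 d21 d2P] := @krylov_generic F _ _ k2 o2 0 M1^T (M2 - M1)^T N 1.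
  by rewrite scaler0 scale1r addr0 -linearD addrC subrK.
have dd0 : d1 * d2 != 0.
  by rewrite mulf_neq0 //; apply/eqP => dE; [move: d10|move: d21]; rewrite dE root0.
have [j] := nat_nonroot dd0; set t : F := j%:R.
rewrite rootM negb_or => /andP[/d1P + /d2P]; rewrite scaler0 addr0 => r1t r2t.
exists (M1 + t *: (M2 - M1)); split; [exact: admissible_line|by []|].
have -> : (M1 + t *: (M2 - M1))^T = M1^T + t *: (M2 - M1)^T.
  by apply/matrixP => a b; rewrite !mxE.
by move: r2t; rewrite scaler0 addr0.
Qed.

Lemma krylov_scale r k (o : 'M[F]_(r, N)) M a :
  a != 0 -> (krylov k o M <= krylov k o (a *: M))%MS.
Proof.
move=> a0; apply/mxcol_subP => i.
have -> : o *m M ^+ i = a ^- i *: (o *m (a *: M) ^+ i).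
  have -> : (a *: M) ^+ i = a ^+ i *: M ^+ i.
    elim: (i : nat) => [|j IH]; first by rewrite !expr0 scale1r.
    by rewrite !exprS IH -[LHS]scalemxAl -scalemxAr scalerA.
  by rewrite -scalemxAr scalerA mulVf ?expf_neq0 // scale1r.
by rewrite scalemx_sub // (sub_mxcol (fun i : 'I_k => o *m (a *: M) ^+ i)).
Qed.

Lemma leader_controls q :
  exists2 M, admissible M & (N <= \rank (krylov m (E q) M^T))%N.
Proof.
have [h [par [par_nb hq obsL]]] := leader_laplacian F (conn q).
set L := tree_laplacian h par in obsL.
pose LL : 'M[F]_N := \sum_i h i *: ((E i)^T *m (E i - E (par i))).
(* [Phi v] is [v] tensored with the identity of size [n]. It intertwines [L^T] with [LL^T], so the
   [m] steps that suffice for the Laplacian suffice for the network. *)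
pose Phi (v : 'rV[F]_m) : 'M[F]_(n, N) := \sum_i v 0 i *: E i.
have PhiD u v : Phi (u + v) = Phi u + Phi v.
  by rewrite -big_split; apply: eq_bigr => i _; rewrite mxE scalerDl.
have PhiZ a v : Phi (a *: v) = a *: Phi v.
  by rewrite scaler_sumr; apply: eq_bigr => i _; rewrite mxE scalerA.
have PhiE i : Phi (delta_mx 0 i) = E i.
  rewrite /Phi (bigD1 i) //= mxE !eqxx scale1r big1 ?addr0 // => j ji.
  by rewrite mxE (negPf ji) andbF scale0r.
have ELL i : E i *m LL^T = Phi (delta_mx 0 i *m L^T).
  rewrite -rowE /LL linear_sum /= mulmx_sumr; apply: eq_bigr => k _.
  rewrite linearZ /= trmx_mul trmxK -scalemxAr linearB /= mulmxA mulmxBr !E_orth.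
  by rewrite !mxE -raddfB /= mul_scalar_mx scalerA [k == i]eq_sym [par k == i]eq_sym.
have PhiLL v : Phi v *m LL^T = Phi (v *m L^T).
  rewrite {1}/Phi mulmx_suml [v in RHS]row_sum_delta mulmx_suml.
  rewrite (big_morph Phi PhiD (_ : Phi 0 = 0)).
    by apply: eq_bigr => i _; rewrite -!scalemxAl ELL PhiZ.
  by rewrite /Phi big1 // => i _; rewrite mxE scale0r.
have PhiK j : E q *m LL^T ^+ j = Phi (delta_mx 0 q *m L^T ^+ j).
  elim: j => [|j IH]; first by rewrite !mulmx1 PhiE.
  by rewrite !exprSr !mulmxA IH PhiLL.
have rLL : (N <= \rank (krylov m (E q) LL^T))%N.
  have /observesP rL := obsL.
  have subE i : (E i <= krylov m (E q) LL^T)%MS.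
    have : ((delta_mx 0 i : 'rV[F]_m) <= krylov m (delta_mx 0 q : 'rV[F]_m) L^T)%MS.
      by apply: submx_full; rewrite /row_full eqn_leq rank_leq_col.
    case/submxP=> D; rewrite -[D](submxrowK) mul_mxrow_mxcol => DE.
    rewrite -PhiE DE (big_morph Phi PhiD (_ : Phi 0 = 0)); last first.
      by rewrite /Phi big1 // => j _; rewrite mxE scale0r.
    apply: summx_sub => j _; rewrite [submxrow D j]mx11_scalar mul_scalar_mx PhiZ.
    rewrite -PhiK scalemx_sub //.
    exact: (sub_mxcol (fun j : 'I_m => E q *m LL^T ^+ j)).
  rewrite -{1}[N](mxrank1 F N) -E_total mxrankS //; apply: summx_sub => i _.
  exact: submx_trans (submxMl _ _) (subE i).
(* Scaling by [t] turns the large feedback [A0 + t^-1 LL] into the small perturbation [LL + t A0] of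
   the Laplacian. *)
have [|d d0 dP] := @krylov_generic F _ _ m (E q) 0 LL^T A0^T N 0.
  by rewrite scaler0 scale0r !addr0.
have dX0 : d * 'X != 0.
  by rewrite mulf_neq0 ?polyX_eq0 //; apply: contraNneq d0 => ->; rewrite root0.
have [j] := nat_nonroot dX0; set t : F := j%:R.
rewrite rootM rootX negb_or => /andP[/dP + t0]; rewrite scaler0 addr0 => rt.
exists (A0 + t^-1 *: LL).
  move=> i; rewrite addrAC subrr add0r -scalemxAr scalemx_sub //.
  rewrite mulmx_sumr; apply: summx_sub => k _.
  rewrite -scalemxAr mulmxA; have [<-|ik] := eqVneq i k; last first.
    by rewrite (block_off E_orth) // mul0mx scaler0 sub0mx.
  rewrite (block_self E_orth) mul1mx.
  have [->|/par_nb] := eqVneq i q; first by rewrite hq scale0r sub0mx.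
  by move=> pi; rewrite scalemx_sub // c_diff.
apply: leq_trans rt (mxrankS _).
have -> : (A0 + t^-1 *: LL)^T = t^-1 *: (LL^T + t *: A0^T).
  by rewrite linearD linearZ /= scalerDr scalerA mulVf // scale1r addrC.
by rewrite krylov_scale // invr_eq0.
Qed.

(** Agents outside [T] keep a zero block, so the number of rows does not depend on [T]. *)
Definition stacked (T : {set 'I_m}) := \mxcol_i ((i \in T)%:R *: c i).

Lemma stacked_eq0 T (x : 'cV[F]_N) :
  stacked T *m x = 0 <-> forall i, i \in T -> c i *m x = 0.
Proof.
rewrite mxcol_eq0P; split=> cx i; last first.
  by rewrite -scalemxAl; case: (boolP (i \in T)) => [/cx ->|_]; rewrite ?scaler0 ?scale0r.
by move=> iT; move: (cx i); rewrite iT scale1r.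
Qed.

(* If [c i x = 0] for all [i] in [T] and [k] in [nb i], then [E i x = E k x], and
   comparing rows [i] and [k] of [M x = l x] shows that the feedback [G (c k)]
   at [k] annihilates [x]; so it suffices to choose [G] injective on the
   observations [c k x] of the eigenvectors [x] without that feedback.  These
   eigenspaces have dimension at most [n], since [k] controls the network. *)
Lemma observability_step (T : {set 'I_m}) i k M1 :
  i \in T -> k \notin T -> k \in nb i ->
  admissible M1 -> observes (stacked (k |: T)) M1 ->
  exists2 M, admissible M & observes (stacked T) M.
Proof.
move=> iT kT ki adm1 /observesP obs1; have [M2 adm2 ctr2] := leader_controls k.
have [M [adm /krylov_observes obs /krylov_observes ctr]] :=
  admissible_both adm1 obs1 adm2 ctr2.
have /submxP[Gk GkE] := adm k.
(* Removing the feedback at [k] restores the open-loop rows of that agent. *)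
pose M0 := M - (E k)^T *m Gk *m c k.
have M0E : E k *m M0 = E k *m A0.
  rewrite mulmxBr !mulmxA (block_self E_orth) mul1mx -GkE mulmxBr opprB addrC subrK //.
(* A left eigenvector of [M0] killed by [(E k)^T] is also one of [M], against controllability from
   [k]. So [(E k)^T] embeds the left eigenspace in dimension [n]. *)
have rker l : (\rank (kermx (M0 - l%:M)) <= n)%N.
  pose W := kermx (M0 - l%:M); rewrite -/W.
  have injW : (W :&: kermx (E k)^T)%MS = 0.
    apply/eqP/rowV0P => u; rewrite sub_capmx => /andP[/eigenspaceP uM /sub_kermxP uE].
    apply/eqP; rewrite -trmx_eq0; apply/eqP/(ctr l); last first.
      by rewrite -[E k]trmxK -trmx_mul uE trmx0.
    rewrite -trmx_mul -[M](subrK ((E k)^T *m Gk *m c k)) -/M0 mulmxDr uM !mulmxA uE.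
    by rewrite !mul0mx addr0 linearZ.
  rewrite -(mxrank_mul_ker W (E k)^T) injW mxrank0 addn0.
  exact: rank_leq_col.
pose Y l := (kermx (M0 - l%:M)^T)^T.
have rY l : (\rank (Y l) <= n)%N.
  by rewrite mxrank_tr mxrank_ker mxrank_tr -mxrank_ker.
have [ls lsP] : exists ls : seq F, forall l x, M0 *m x = l *: x -> x != 0 :> 'cV_N -> l \in ls.
  have [ls chE] := closed_field_poly_normal (char_poly M0^T); exists ls => l x Mx x0.
  have : root (char_poly M0^T) l.
    rewrite -eigenvalue_root_char; apply/eigenvalueP; exists x^T; last by rewrite trmx_eq0.
    by rewrite -trmx_mul Mx linearZ.
  by rewrite chE (monicP (char_poly_monic _)) scale1r root_prod_XsubC.
have [G GP] := @rank_preserving_mul F n _ _ ls (fun l => c k *m Y l)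
  (fun l => leq_trans (mxrankM_maxr _ _) (rY l)).
pose M' := M0 + (E k)^T *m G *m c k.
have M'E : M' = M + (E k)^T *m (G - Gk) *m c k.
  by rewrite /M' /M0 mulmxBr mulmxBl addrAC addrA.
have adm' : admissible M' by rewrite M'E; apply: (admissible_feedback E_orth).
exists M' => // l x M'x /stacked_eq0 cTx; apply/eqP/negPn/negP => x0.
have Eik : E i *m x = E k *m x.
  have /submxP[D Dc] := c_diff ki; apply/eqP; rewrite -subr_eq0 -mulmxBl Dc.
  by rewrite -mulmxA cTx // mulmx0.
have ik : i != k by apply: contraNneq kT => <-.
have EiM' : E i *m M' *m x = E i *m A0 *m x.
  have /submxP[D Dc] := adm' i; apply/eqP.
  by rewrite -subr_eq0 -mulmxBl -mulmxBr Dc -mulmxA cTx // mulmx0.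
have Gcx : G *m (c k *m x) = 0.
  have : E k *m M' *m x = E k *m A0 *m x.
    by rewrite -(A0_diff Eik) -EiM' -!mulmxA M'x -!scalemxAr Eik.
  rewrite mulmxDr M0E !mulmxA (block_self E_orth) mul1mx mulmxDl => /eqP.
  by rewrite -[X in _ == X]addr0 (inj_eq (addrI _)) -mulmxA => /eqP.
have M0x : M0 *m x = l *: x.
  rewrite -M'x [RHS]mulmxDl -[X in _ = _ + X]mulmxA -[X in _ = _ + X]mulmxA Gcx.
  by rewrite mulmx0 addr0.
have ckx : c k *m x = 0.
  have /submxP[D xD] : (x^T <= kermx (M0 - l%:M)^T)%MS.
    by rewrite sub_kermx -trmx_mul mulmxBl M0x mul_scalar_mx subrr trmx0.
  have {xD}xY : x = Y l *m D^T by rewrite -[x]trmxK xD trmx_mul.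
  have := GP l (lsP l x M0x x0).
  rewrite (geq_leqif (mxrank_leqif_sup (submxMl _ _))) => /submxP[D' ZD'].
  by rewrite xY mulmxA ZD' -!mulmxA -xY Gcx mulmx0.
move/negP: x0; apply; apply/eqP/(obs l).
  by rewrite -[M](subrK ((E k)^T *m Gk *m c k)) -/M0 mulmxDl M0x -mulmxA ckx mulmx0 addr0.
by apply/stacked_eq0 => j; rewrite !inE => /predU1P[->|/cTx].
Qed.

(** Induction on the number of agents outside [T]: for the full set [joint] applies to [A0], and
    each removal uses an arc entering [T]. *)
Lemma leader_observes q : exists2 M, admissible M & observes (c q) M.
Proof.
suff obsT d (T : {set 'I_m}) : q \in T -> (#|~: T| <= d)%N ->
    exists2 M, admissible M & observes (stacked T) M.
  have [M adm obs] := obsT _ [set q] (set11 q) (leqnn _); exists M => // l x Mx cx.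
  by apply: (obs l x Mx); apply/stacked_eq0 => i; rewrite inE => /eqP ->.
elim: d T => [|d IH] T qT cardT.
  exists A0 => [i|l x Ax /stacked_eq0 cx]; first by rewrite subrr mulmx0 sub0mx.
  apply: joint Ax _ => i; apply: cx; move: cardT; rewrite leqn0 cards_eq0.
  by move/eqP/setP/(_ i); rewrite !inE => /negbFE.
have [TT|TT] := eqVneq T setT.
  by apply: IH => //; rewrite TT setCT cards0.
have [k [i [kT iT ki]]] := connect_entering (fun i => conn i q) qT TT.
have [||M adm obs] := IH (k |: T).
- by rewrite !inE qT orbT.
- rewrite -ltnS (leq_trans _ cardT) // [in X in (_ < X)%N](cardsD1 k) inE kT add1n ltnS.
  by rewrite subset_leq_card //; apply/subsetP => j; rewrite !inE negb_or.
exact: (observability_step iT kT ki adm obs).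
Qed.

Theorem single_output_leader q :
  exists M (g : 'rV[F]_(s q)), [/\ admissible M,
    (N <= \rank (krylov N (g *m c q) M))%N &
    (N <= \rank (krylov m (E q) M^T))%N].
Proof.
have [M1 adm1 /observesP obs1] := leader_observes q.
have [M2 adm2 ctr2] := leader_controls q.
have [M [adm /krylov_observes obs /krylov_observes ctr]] :=
  admissible_both adm1 obs1 adm2 ctr2.
have [|G [g /observesP gobs]] := @single_output F _ _ _ M (E q)^T (c q) _ obs.
  by rewrite trmxK.
(* The feedback that makes one output suffice may destroy spanning in [m] steps, so a generic point
   towards [M2] is taken once more. *)
have [M' [adm' obs' ctr']] :=
  admissible_both (admissible_feedback E_orth G adm) gobs adm2 ctr2.
by exists M', g.
Qed.

End Network.

(** * Pole placement by a dynamic compensator *)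

Section DividedDifference.
Variable F : fieldType.
Implicit Types (a : nat -> F) (g : {poly F}).

(* If [a j = w M^j v], then [hankel_sum k a = w ((X^k - M^k) / (X - M)) v], and
   [divided_diff g a = w ((g(X) - g(M)) / (X - M)) v]. *)
Fixpoint hankel_sum k a : {poly F} :=
  if k is k'.+1 then (a k')%:P + 'X * hankel_sum k' a else 0.

Definition divided_diff g a := \sum_(k < size g) g`_k *: hankel_sum k a.

Lemma hankel_sumSr k a :
  hankel_sum k.+1 a = a 0%N *: 'X^k + hankel_sum k (fun j => a j.+1).
Proof.
elim: k => [|k IH]; first by rewrite /= expr0 alg_polyC mulr0 addr0.
rewrite [LHS]/= -/(hankel_sum k.+1 a) IH /= mulrDr addrCA; congr (_ + _).
by rewrite -scalerAr -exprS.
Qed.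

Lemma size_hankel_sum k a : (size (hankel_sum k a) <= k)%N.
Proof.
elim: k => [|k IH] /=; first by rewrite size_poly0.
rewrite (leq_trans (size_polyD _ _)) // geq_max (leq_trans (size_polyC_leq1 _)) //=.
by rewrite (leq_trans (size_polyMleq _ _)) // size_polyX.
Qed.

Lemma hankel_sum_linear k x a b :
  hankel_sum k (fun j => x * a j + b j) = x *: hankel_sum k a + hankel_sum k b.
Proof.
elim: k => [|k IH] /=; first by rewrite scaler0 addr0.
by rewrite IH polyCD polyCM -!mul_polyC; ring.
Qed.

Lemma divided_diff_linear g x a b :
  divided_diff g (fun j => x * a j + b j) =
  x *: divided_diff g a + divided_diff g b.
Proof.
rewrite scaler_sumr -big_split; apply: eq_bigr => k _ /=.
by rewrite hankel_sum_linear scalerDr !scalerA [x * _]mulrC.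
Qed.

(** With [a j = w M^j v], this is [(X - M) Q = g(X) - g(M)] for the quotient [Q], read between [w]
    and [v]; shifting [a] replaces [v] by [M v]. *)
Lemma divided_diff_shift g a :
  'X * divided_diff g a = divided_diff g (fun j => a j.+1)
    + a 0%N *: g - (\sum_(k < size g) g`_k * a k)%:P.
Proof.
rewrite -[g in a 0%N *: g]coefK poly_def scaler_sumr rmorph_sum /= mulr_sumr.
rewrite -big_split -sumrB; apply: eq_bigr => k _ /=.
have -> : 'X * (g`_k *: hankel_sum k a) = g`_k *: ('X * hankel_sum k a).
  by rewrite scalerAr.
have -> : 'X * hankel_sum k a =
    a 0%N *: 'X^k + hankel_sum k (fun j => a j.+1) - (a k)%:P.
  by rewrite -hankel_sumSr /= addrC addKr.
by rewrite polyCM -!mul_polyC; ring.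
Qed.

Lemma eq_divided_diff g a b : a =1 b -> divided_diff g a = divided_diff g b.
Proof.
move=> ab; apply: eq_bigr => k _; congr (_ *: _).
by elim: (k : nat) => //= j ->; rewrite ab.
Qed.

Lemma size_divided_diff g a : (size (divided_diff g a) <= (size g).-1)%N.
Proof.
apply: (leq_trans (size_sum _ _ _)); apply/bigmax_leqP => k _.
rewrite (leq_trans (size_scale_leq _ _)) // (leq_trans (size_hankel_sum _ _)) //.
by rewrite -ltnS (leq_trans (ltn_ord k)) // leqSpred.
Qed.

End DividedDifference.

Lemma row_mx_suml (V : nmodType) I (l : seq I) p m1 m2 (f : I -> 'M[V]_(p, m1)) :
  row_mx (\sum_(i <- l) f i) (0 : 'M_(p, m2)) = \sum_(i <- l) row_mx (f i) 0.
Proof.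
elim: l => [|i l IH]; first by rewrite !big_nil row_mx0.
by rewrite !big_cons -IH add_row_mx addr0.
Qed.

Lemma row_mx_sumr (V : nmodType) I (l : seq I) p m1 m2 (f : I -> 'M[V]_(p, m2)) :
  row_mx (0 : 'M_(p, m1)) (\sum_(i <- l) f i) = \sum_(i <- l) row_mx 0 (f i).
Proof.
elim: l => [|i l IH]; first by rewrite !big_nil row_mx0.
by rewrite !big_cons -IH add_row_mx addr0.
Qed.

Section MatrixEvaluation.
Variables (F : fieldType) (d : nat).
Implicit Types (Z : 'M[F]_d) (p : {poly F}).

(* [horner_mx] only accepts dimensions of the form [d.+1]. *)
Definition evalmx Z p : 'M[F]_d := \sum_(i < size p) p`_i *: Z ^+ i.

Lemma evalmx_widen Z p k :
  (size p <= k)%N -> evalmx Z p = \sum_(i < k) p`_i *: Z ^+ i.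
Proof.
move=> pk; rewrite /evalmx (big_ord_widen k (fun i => p`_i *: Z ^+ i) pk).
rewrite big_mkcond; apply: eq_bigr => i _; case: ltnP => // pi.
by rewrite nth_default // scale0r.
Qed.

Lemma mulmx_evalmx Z p k (y : 'rV[F]_d) :
  (size p <= k)%N -> y *m evalmx Z p = \sum_(i < k) p`_i *: (y *m Z ^+ i).
Proof.
move/evalmx_widen->; rewrite mulmx_sumr.
by apply: eq_bigr => i _; rewrite scalemxAr.
Qed.

Lemma evalmx_linear Z a p q : evalmx Z (a *: p + q) = a *: evalmx Z p + evalmx Z q.
Proof.
have pk := leq_maxl (size p) (size q); have qk := leq_maxr (size p) (size q).
rewrite !(@evalmx_widen Z _ (maxn (size p) (size q))) //; last first.
  by rewrite (leq_trans (size_polyD _ _)) // geq_max qk (leq_trans (size_scale_leq _ _)).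
rewrite scaler_sumr -big_split; apply: eq_bigr => i _ /=.
by rewrite coefD coefZ scalerDl scalerA.
Qed.

Lemma evalmxD Z p q : evalmx Z (p + q) = evalmx Z p + evalmx Z q.
Proof. by have := evalmx_linear Z 1 p q; rewrite !scale1r. Qed.

Lemma evalmx0 Z : evalmx Z 0 = 0.
Proof. by rewrite /evalmx size_poly0 big_ord0. Qed.

Lemma evalmxZ Z a p : evalmx Z (a *: p) = a *: evalmx Z p.
Proof. by have := evalmx_linear Z a p 0; rewrite evalmx0 !addr0. Qed.

Lemma evalmxB Z p q : evalmx Z (p - q) = evalmx Z p - evalmx Z q.
Proof. by rewrite evalmxD -scaleN1r evalmxZ scaleN1r. Qed.

Lemma evalmx_sum Z I (l : seq I) (f : I -> {poly F}) :
  evalmx Z (\sum_(i <- l) f i) = \sum_(i <- l) evalmx Z (f i).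
Proof. exact: (big_morph _ (evalmxD Z) (evalmx0 Z)). Qed.

End MatrixEvaluation.

Lemma evalmxE (F : fieldType) (d : nat) (Z : 'M[F]_d.+1) p : evalmx Z p = horner_mx Z p.
Proof.
rewrite -[in RHS](coefK p) poly_def rmorph_sum; apply: eq_bigr => i _.
by rewrite /= linearZ /= rmorphXn /= horner_mx_X.
Qed.

Section MatrixEvaluationMul.
Variables (F : fieldType) (d : nat) (Z : 'M[F]_d).
Implicit Types p q : {poly F}.

Lemma evalmxM p q : evalmx Z (p * q) = evalmx Z p *m evalmx Z q.
Proof.
case: d Z => [|d'] Z'; first by apply/matrixP => -[].
by rewrite !evalmxE rmorphM.
Qed.

Lemma evalmxX : evalmx Z 'X = Z.
Proof.
case: d Z => [|d'] Z'; first by apply/matrixP => -[].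
by rewrite evalmxE horner_mx_X.
Qed.

Lemma evalmxXn k : evalmx Z 'X^k = Z ^+ k.
Proof.
case: d Z => [|d'] Z'; first by apply/matrixP => -[].
by rewrite evalmxE rmorphXn /= horner_mx_X.
Qed.

Lemma evalmx_char_poly : evalmx Z (char_poly Z) = 0.
Proof.
case: d Z => [|d'] Z'; first by apply/matrixP => -[].
by rewrite evalmxE Cayley_Hamilton.
Qed.

End MatrixEvaluationMul.

(** * Transfer-function numerators and the compensator equation *)

Section Observer.
Variables (F : fieldType) (N : nat).
Variables (M : 'M[F]_N) (w : 'rV[F]_N).
Hypothesis w_cyclic : (N <= \rank (krylov N w M))%N.

Definition markov (v : 'cV[F]_N) j := (w *m M ^+ j *m v) 0 0.
(** This is [w adj(X - M) v], the numerator of the transfer function [w (X - M)^-1 v]. *)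
Definition numerator v := divided_diff (char_poly M) (markov v).

Lemma numerator_shift v :
  'X * numerator v = numerator (M *m v) + (w *m v) 0 0 *: char_poly M.
Proof.
rewrite divided_diff_shift.
have -> : \sum_(k < size (char_poly M)) (char_poly M)`_k * markov v k = 0.
  transitivity ((w *m evalmx M (char_poly M) *m v) 0 0); last first.
    by rewrite evalmx_char_poly mulmx0 mul0mx mxE.
  rewrite (mulmx_evalmx _ _ (leqnn _)) mulmx_suml summxE; apply: eq_bigr => k _.
  by rewrite -scalemxAl mxE.
rewrite subr0 [markov v 0]/markov expr0 mulmx1; congr (_ + _).
by apply: eq_divided_diff => j; rewrite /markov exprSr !mulmxA.
Qed.

Lemma size_numerator v : (size (numerator v) <= N)%N.
Proof. by have := size_divided_diff (char_poly M) (markov v); rewrite size_char_poly. Qed.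

Lemma numerator_linear x u v :
  numerator (x *: u + v) = x *: numerator u + numerator v.
Proof.
rewrite -divided_diff_linear; apply: eq_divided_diff => j.
by rewrite /markov mulmxDr -scalemxAr !mxE.
Qed.

Lemma numeratorD u v : numerator (u + v) = numerator u + numerator v.
Proof. by have := numerator_linear 1 u v; rewrite !scale1r. Qed.

Lemma numerator0 : numerator 0 = 0.
Proof. by apply: (addrI (numerator 0)); rewrite -numeratorD !addr0. Qed.

(** In [numerator_shift] the numerator has degree below that of [char_poly M], so both terms on the
    right vanish. Iterating gives [w M^k v = 0] for all [k]. *)
Lemma numerator_inj v : numerator v = 0 -> v = 0.
Proof.
move=> v0; have num0 k : numerator (M ^+ k *m v) = 0 /\ w *m M ^+ k *m v = 0.
  suff step u : numerator u = 0 -> numerator (M *m u) = 0 /\ w *m u = 0.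
    have numk : numerator (M ^+ k *m v) = 0.
      elim: k => [|k IH]; first by rewrite mul1mx.
      by rewrite exprS -mulmxA; have [] := step _ IH.
    by split=> //; rewrite -mulmxA; have [] := step _ numk.
  move=> u0; have := numerator_shift u; rewrite u0 mulr0 => sh.
  have wu : (w *m u) 0 0 = 0.
    apply/eqP; apply: contraTT isT => wu0.
    have := size_numerator (M *m u).
    move/esym/eqP: sh; rewrite addr_eq0 => /eqP ->.
    by rewrite size_polyN size_scale // size_char_poly ltnn.
  split; last by rewrite [LHS]mx11_scalar wu; apply/matrixP => i j; rewrite !mxE mul0rn.
  by move/esym: sh; rewrite wu scale0r addr0.
have Kv : krylov N w M *m v = 0.
  by apply/mxcol_eq0P => k; have [] := num0 k.
have Kf : row_full (krylov N w M) by rewrite /row_full eqn_leq rank_leq_col.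
by rewrite -[v]mul1mx -(mulVpmx Kf) -mulmxA Kv mulmx0.
Qed.

Lemma numerator_surj (p : {poly F}) :
  (size p <= N)%N -> exists v, numerator v = p.
Proof.
move=> pN; pose T : 'M[F]_N := \matrix_i poly_rV (numerator (delta_mx i 0)).
have TE (u : 'rV[F]_N) : u *m T = poly_rV (numerator u^T).
  have uE : u^T = \sum_i u 0 i *: delta_mx i 0.
    rewrite [u in LHS]row_sum_delta [LHS]linear_sum; apply: eq_bigr => i _.
    by rewrite linearZ /= trmx_delta.
  rewrite mulmx_sum_row uE (big_morph numerator numeratorD numerator0) [RHS]linear_sum.
  apply: eq_bigr => i _ /=; rewrite rowK.
  by rewrite -[_ *: delta_mx i 0]addr0 numerator_linear numerator0 addr0 linearZ.
have Tfree : row_free T.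
  apply: inj_row_free => u; rewrite TE => /(congr1 rVpoly).
  rewrite linear0 poly_rV_K ?size_numerator // => /numerator_inj /eqP.
  by rewrite trmx_eq0 => /eqP.
have /submxP[u pu] : (poly_rV p <= T)%MS.
  by apply: submx_full; rewrite row_full_unit -row_free_unit.
exists u^T; rewrite -[RHS](poly_rV_K pN) pu TE poly_rV_K //.
exact: size_numerator.
Qed.

(** Numerators identify column vectors with residues modulo [char_poly M], the action of [M]
    becoming multiplication by [X]. *)
Lemma numerator_mulX k v :
  char_poly M %| 'X^k * numerator v - numerator (M ^+ k *m v).
Proof.
elim: k => [|k IH]; first by rewrite mul1r mul1mx subrr dvdp0.
rewrite exprS exprS -mulrA -mulmxA -(subrK (numerator (M ^+ k *m v)) ('X^k * _)).
rewrite mulrDr numerator_shift addrA addrAC -addrA addrC addrAC addrK.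
by rewrite dvdp_add ?dvdp_mull // -mul_polyC dvdp_mull.
Qed.

Variables (n mu : nat) (b : 'M[F]_(N, n)).
Hypothesis b_index : (N <= \rank (krylov mu.+1 b^T M^T))%N.

(** Choose [v] with numerator [- chi] modulo [char_poly M] and expand it as the sum of [M^k b P k].
    Then [char_poly M] divides [chi + h]; as [h] has degree below that of [chi], the quotient [r] is
    monic of degree [mu]. *)
Lemma compensator_equation (chi : {poly F}) :
  chi \is monic -> size chi = (N + mu).+1 ->
  exists (r : {poly F}) (P : 'I_mu.+1 -> 'cV[F]_n), [/\ r \is monic, size r = mu.+1 &
    chi = char_poly M * r - \sum_(k < mu.+1) 'X^k * numerator (b *m P k)].
Proof.
move=> chi_monic chi_size; set psi := char_poly M.
have psi_size : size psi = N.+1 by rewrite size_char_poly.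
have psi0 : psi != 0 by rewrite monic_neq0 ?char_poly_monic.
have [v vE] : exists v, numerator v = - (chi %% psi).
  apply: numerator_surj; rewrite size_polyN -ltnS -psi_size ltn_modp //.
have [P vP] : exists P : 'I_mu.+1 -> 'cV[F]_n, v = \sum_(k < mu.+1) M ^+ k *m (b *m P k).
  have /submxP[D vD] : (v^T <= krylov mu.+1 b^T M^T)%MS.
    by apply: submx_full; rewrite /row_full eqn_leq rank_leq_col.
  exists (fun k => (submxrow D k)^T).
  rewrite -[LHS]trmxK vD -[D in LHS]submxrowK mul_mxrow_mxcol linear_sum.
  apply: eq_bigr => k _ /=; rewrite !trmx_mul trmxK mulmxA; congr (_ *m _ *m _).
  elim: (k : nat) => [|j IH]; first by rewrite !expr0 trmx1.
  by rewrite exprSr exprS trmx_mul trmxK IH.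
pose h := \sum_(k < mu.+1) 'X^k * numerator (b *m P k); rewrite -/h.
have /dvdpP[s hs] : psi %| h - numerator v.
  rewrite vP (big_morph numerator numeratorD numerator0) -sumrB.
  elim/big_ind: _ => [|x y|k _]; [exact: dvdp0|exact: dvdp_add|].
  exact: numerator_mulX.
have size_h : (size h <= N + mu)%N.
  apply: (leq_trans (size_sum _ _ _)); apply/bigmax_leqP => k _.
  rewrite (leq_trans (size_polyMleq _ _)) // size_polyXn /=.
  by rewrite addnC leq_add ?size_numerator // -ltnS.
pose r := chi %/ psi + s.
have rE : chi + h = psi * r.
  by rewrite -[h](subrK (numerator v)) hs vE {1}(divp_eq chi psi) /r; ring.
have ch_size : size (chi + h) = (N + mu).+1.
  by rewrite size_polyDl chi_size // ltnS.
have ch_monic : chi + h \is monic.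
  by rewrite monicE lead_coefDl ?chi_size ?ltnS // -monicE.
exists r, P; split; last by rewrite -rE addrK.
  by move: ch_monic; rewrite rE (monicMl _ (char_poly_monic M)).
have r0 : r != 0.
  by apply/eqP => r0; move: ch_size; rewrite rE r0 mulr0 size_poly0.
move: ch_size; rewrite rE size_mul // psi_size addSn /= => /eqP.
by rewrite -addnS eqn_add2l => /eqP.
Qed.

(** * The companion realization and its characteristic polynomial *)

Section Compensator.
Variables (r : {poly F}) (P : 'I_mu.+1 -> 'cV[F]_n).
Hypotheses (r_monic : r \is monic) (r_size : size r = mu.+1).

(* The [k]-th derivative of the first compensator state, as a row of the closed
   loop: the compensator is the companion realization of
   [r(d/dt) z = w e], [u = P(d/dt) z]. *)
Definition jet k : 'rV[F]_(N + mu) :=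
  row_mx ((k == mu)%:R *: w)
    (\row_(j < mu) (if k == mu then - r`_j else (k == j)%:R)).

(** The derivative of order [mu] in the input is eliminated by [r(d/dt) z = w e]: its coefficient
    [P ord_max] becomes a direct gain on [w e] and corrects the other coefficients in [comp_C]. *)
Definition comp_D : 'cV[F]_n := P ord_max.
Definition comp_C : 'M[F]_(n, mu) :=
  \matrix_(i, j) (P (widen_ord (leqnSn mu) j) i 0 - r`_j * P ord_max i 0).
Definition comp_K : 'cV[F]_mu := \col_(k < mu) (k.+1 == mu)%:R.
Definition comp_A : 'M[F]_mu :=
  \matrix_(k, j) (if k.+1 == mu then - r`_j else (k.+1 == j)%:R).
Definition closed_loop : 'M[F]_(N + mu) :=
  block_mx (M + b *m comp_D *m w) (b *m comp_C) (comp_K *m w) comp_A.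

Local Notation Z := closed_loop.
Let y := jet 0.
Let Y := \sum_(k < mu.+1) P k *m jet k.

Lemma input_jet : Y = row_mx (comp_D *m w) comp_C.
Proof.
rewrite /Y big_ord_recr /= /jet eqxx scale1r mul_mx_row.
rewrite (eq_bigr (fun k : 'I_mu => row_mx 0
    (P (widen_ord (leqnSn mu) k) *m (delta_mx 0 k : 'rV_mu)))); last first.
  move=> k _; rewrite mul_mx_row (ltn_eqF (ltn_ord k)) scale0r mulmx0.
  by congr (row_mx _ (_ *m _)); apply/rowP => j; rewrite !mxE eq_sym.
rewrite -row_mx_sumr add_row_mx add0r; congr row_mx.
apply/matrixP => i j; rewrite !mxE summxE (bigD1 j) //= big1 => [|k kj].
  by rewrite !mxE !big_ord1 !mxE !eqxx mulr1 addr0 mulrN mulrC.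
by rewrite !mxE big_ord1 !mxE [j == k]eq_sym (negPf kj) andbF mulr0.
Qed.

Lemma plant_row (u : 'rV[F]_N) : row_mx u 0 *m Z = row_mx (u *m M) 0 + u *m b *m Y.
Proof.
rewrite mul_row_block !mul0mx !addr0 input_jet mul_mx_row add_row_mx add0r.
by rewrite mulmxDr !mulmxA.
Qed.

Lemma jet_step k : (k < mu)%N -> jet k *m Z = jet k.+1.
Proof.
move=> kmu; rewrite /jet (ltn_eqF kmu) scale0r mul_row_block !mul0mx !add0r.
have -> : \row_(j < mu) (k == j)%:R = delta_mx 0 (Ordinal kmu) :> 'rV[F]_mu.
  by apply/rowP => j; rewrite !mxE eq_sym.
rewrite mulmxA -!rowE; congr row_mx; last by apply/rowP => j; rewrite !mxE.
rewrite [row _ comp_K]mx11_scalar mul_scalar_mx; congr (_ *: _).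
by rewrite !mxE.
Qed.

Lemma jetE k : (k <= mu)%N -> jet k = y *m Z ^+ k.
Proof.
elim: k => [|k IH] kmu; first by rewrite mulmx1.
by rewrite exprSr mulmxA -IH ?(ltnW kmu) // jet_step.
Qed.

(** This is [r(d/dt) z = w e], powers of [Z] standing for time derivatives. *)
Lemma jet_denominator : y *m evalmx Z r = row_mx w 0.
Proof.
rewrite (mulmx_evalmx _ _ (eq_leq r_size)) big_ord_recr /=.
have -> : r`_mu = 1 by move/monicP: r_monic; rewrite lead_coefE r_size.
rewrite scale1r -jetE //.
transitivity (\sum_(k < mu) row_mx (0 : 'rV_N)
    (r`_k *: (delta_mx 0 k : 'rV_mu)) + jet mu).
  congr (_ + _); apply: eq_bigr => k _.
  rewrite -jetE ?(ltnW (ltn_ord k)) // /jet (ltn_eqF (ltn_ord k)).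
  rewrite scale0r scale_row_mx scaler0.
  by congr (row_mx _ (_ *: _)); apply/rowP => j; rewrite !mxE eq_sym.
rewrite -row_mx_sumr /jet eqxx scale1r add_row_mx add0r; congr row_mx.
apply/rowP => j; rewrite !mxE summxE (bigD1 j) //= big1 => [|k kj].
  by rewrite !mxE !eqxx mulr1 addr0 subrr.
by rewrite !mxE [j == k]eq_sym (negPf kj) andbF mulr0.
Qed.

(** Differentiating [w e] [k] times gives [w M^k e] plus the sum over [j < k] of [w M^(k-1-j) b]
    applied to the [j]-th derivative of [u = P(d/dt) z]; the Hankel sums collect the latter. *)
Lemma output_jet k :
  row_mx w 0 *m Z ^+ k = row_mx (w *m M ^+ k) 0 +
    y *m evalmx Z (\sum_(i < mu.+1) 'X^i * hankel_sum k (markov (b *m P i))).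
Proof.
elim: k => [|k IH].
  by rewrite !mulmx1 big1 ?evalmx0 ?mulmx0 ?addr0 // => i _; rewrite mulr0.
rewrite exprSr mulmxA IH mulmxDl plant_row -addrA.
have -> : w *m M ^+ k.+1 = w *m M ^+ k *m M by rewrite exprSr mulmxA.
congr (_ + _); set S := \sum_(i < _) _.
have -> : y *m evalmx Z S *m Z = y *m evalmx Z (S * 'X).
  by rewrite evalmxM evalmxX mulmxA.
rewrite /S /Y mulmx_sumr mulr_suml !evalmx_sum !mulmx_sumr -big_split.
apply: eq_bigr => i _ /=; rewrite jetE; last by rewrite -ltnS.
rewrite mulrDr evalmxD mulmxDr; congr (_ + _); last first.
  by congr (_ *m evalmx _ _); ring.
rewrite mulrC mul_polyC evalmxZ evalmxXn -scalemxAr.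
rewrite !mulmxA -[w *m _ *m b *m P i]mulmxA [X in X *m y]mx11_scalar.
by rewrite mul_scalar_mx -!scalemxAl.
Qed.

(** Apply [char_poly M] of [d/dt] to [r(d/dt) z = w e]: by Cayley-Hamilton only the input terms of
    [output_jet] survive. *)
Lemma closed_loop_annihilates :
  y *m evalmx Z (char_poly M * r - \sum_(k < mu.+1) 'X^k * numerator (b *m P k)) = 0.
Proof.
rewrite mulrC evalmxB evalmxM mulmxBr mulmxA jet_denominator.
apply/eqP; rewrite subr_eq0; apply/eqP.
rewrite (mulmx_evalmx _ _ (leqnn _)).
transitivity (row_mx (w *m evalmx M (char_poly M)) 0 +
   y *m evalmx Z (\sum_(k < mu.+1) 'X^k * numerator (b *m P k))); last first.
  by rewrite evalmx_char_poly mulmx0 row_mx0 add0r.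
under eq_bigr do rewrite output_jet scalerDr.
rewrite big_split /=; congr (_ + _).
  rewrite (mulmx_evalmx _ _ (leqnn _)).
  by rewrite row_mx_suml; apply: eq_bigr => i _; rewrite scale_row_mx scaler0.
under eq_bigr do rewrite scalemxAr -evalmxZ.
rewrite -mulmx_sumr -evalmx_sum; congr (_ *m evalmx _ _).
transitivity (\sum_(i < size (char_poly M)) \sum_(k < mu.+1)
    (char_poly M)`_i *: ('X^k * hankel_sum i (markov (b *m P k)))).
  by apply: eq_bigr => i _; exact: scaler_sumr.
rewrite exchange_big; apply: eq_bigr => k _ /=; rewrite mulr_sumr.
by apply: eq_bigr => i _; rewrite scalerAr.
Qed.

(** The jets of [y] yield the compensator coordinates, then [w] and the input [Y]; subtracting
    inputs in [plant_row] yields every [w M^k]. *)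
Lemma closed_loop_cyclic : (1%:M <= krylov (N + mu) y Z)%MS.
Proof.
set V := krylov _ _ _; have VZ : (V *m Z <= V)%MS by exact: krylov_stable.
have jetV k : (k <= mu)%N -> (jet k <= V)%MS.
  elim: k => [|k IH] kmu; first exact: sub_krylov.
  by rewrite -jet_step // (submx_trans (submxMr _ (IH (ltnW kmu)))).
have YV : (Y <= V)%MS.
  by apply: summx_sub => k _; rewrite mulmx_sub // jetV // -ltnS.
have deltaV (k : 'I_mu) : (row_mx 0 (delta_mx 0 k : 'rV_mu) <= V)%MS.
  have := jetV k (ltnW (ltn_ord k)); rewrite /jet (ltn_eqF (ltn_ord k)) scale0r.
  congr (row_mx _ _ <= _)%MS; apply/rowP => j; rewrite !mxE eq_sym //.
have rowV (v : 'rV_mu) : (row_mx (0 : 'rV_N) v <= V)%MS.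
  rewrite [v]row_sum_delta row_mx_sumr.
  apply: summx_sub => k _; rewrite -[0](scaler0 _ (v 0 k)) -scale_row_mx.
  exact: scalemx_sub.
have wMV k : (row_mx (w *m M ^+ k) 0 <= V)%MS.
  elim: k => [|k IH].
    have := jetV mu (leqnn _); rewrite mulmx1 /jet eqxx scale1r; set v := \row__ _.
    move=> jV; rewrite -[row_mx w 0](addrK (row_mx 0 v)) add_row_mx addr0 add0r.
    by rewrite addmx_sub // eqmx_opp rowV.
  have -> : w *m M ^+ k.+1 = w *m M ^+ k *m M by rewrite exprSr mulmxA.
  have -> := canRL (addrK _) (esym (plant_row (w *m M ^+ k))).
  by rewrite addmx_sub ?(submx_trans (submxMr _ IH)) // eqmx_opp mulmx_sub.
have rowV' (v : 'rV_N) : (row_mx v (0 : 'rV_mu) <= V)%MS.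
  have /submxP[D ->] : (v <= krylov N w M)%MS.
    by apply: submx_full; rewrite /row_full eqn_leq rank_leq_col.
  rewrite -[D](submxrowK) mul_mxrow_mxcol row_mx_suml.
  apply: summx_sub => j _; rewrite [submxrow D j]mx11_scalar mul_scalar_mx.
  by rewrite -[X in row_mx _ X](scaler0 _ (submxrow D j 0 0)) -scale_row_mx scalemx_sub.
apply/row_subP => i; rewrite -[row i _]hsubmxK.
set u := lsubmx _; set v := rsubmx _.
have -> : row_mx u v = row_mx u 0 + row_mx 0 v by rewrite add_row_mx addr0 add0r.
exact: addmx_sub.
Qed.

(* [y] is a cyclic row for the closed loop [Z], so a polynomial of degree less than
   [N + mu] vanishing on [Z] from [y] is zero. *)
Lemma closed_loop_char_poly chi : chi \is monic -> size chi = (N + mu).+1 ->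
    chi = char_poly M * r - \sum_(k < mu.+1) 'X^k * numerator (b *m P k) ->
  char_poly Z = chi.
Proof.
move=> chi_monic chi_size chiE; apply/eqP; rewrite eq_sym -subr_eq0; apply/eqP.
set delta := chi - _.
have delta_size : (size delta <= N + mu)%N.
  apply/leq_sizeP => j; rewrite leq_eqVlt => /predU1P[<-|jN]; rewrite coefB.
    have /monicP := chi_monic; have /monicP := char_poly_monic Z.
    by rewrite !lead_coefE chi_size size_char_poly /= => -> ->; rewrite subrr.
  by rewrite !nth_default ?subrr // ?chi_size ?size_char_poly.
have y_delta : y *m evalmx Z delta = 0.
  by rewrite evalmxB mulmxBr evalmx_char_poly mulmx0 subr0 chiE closed_loop_annihilates.
(* [K] has the rows of the Krylov matrix, indexed so as to form a square matrix. *)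
pose K := \matrix_(i < N + mu) (y *m Z ^+ i).
have Kfree : row_free K.
  rewrite row_free_unit -row_full_unit -sub1mx.
  apply: submx_trans closed_loop_cyclic _; apply/mxcol_subP => i.
  by rewrite -[X in (X <= _)%MS](rowK (fun i => y *m Z ^+ i)) row_sub.
have : poly_rV delta *m K = 0 *m K.
  rewrite mul0mx -y_delta (mulmx_evalmx _ _ delta_size) mulmx_sum_row.
  by apply: eq_bigr => i _; rewrite rowK mxE.
move/(row_free_inj Kfree)/(congr1 rVpoly); rewrite linear0 poly_rV_K //.
Qed.

End Compensator.

End Observer.

Lemma compensator_placement (F : fieldType) (N n mu : nat) (M : 'M[F]_N)
    (b : 'M[F]_(N, n)) (w : 'rV[F]_N) (chi : {poly F}) :
  (N <= \rank (krylov N w M))%N -> (N <= \rank (krylov mu.+1 b^T M^T))%N ->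
  chi \is monic -> size chi = (N + mu).+1 ->
  exists (D : 'cV[F]_n) (Cz : 'M[F]_(n, mu)) (K : 'cV[F]_mu) (Az : 'M[F]_mu),
    char_poly (block_mx (M + b *m D *m w) (b *m Cz) (K *m w) Az) = chi.
Proof.
move=> w_cyclic b_index chi_monic chi_size.
have [r [P [r_monic r_size chiE]]] :=
  compensator_equation w_cyclic b_index chi_monic chi_size.
exists (comp_D P), (comp_C r P), (comp_K F mu), (comp_A mu r).
exact: (closed_loop_char_poly w_cyclic r_monic r_size chi_monic chi_size chiE).
Qed.

(** * The error system *)

Section BlockProjections.
Variables (K : fieldType) (n m : nat).
Local Notation N := (\sum_(i < m) n)%N.

Definition blk (i : 'I_m) : 'M[K]_(n, N) := \mxrow_(j < m) ((i == j)%:R%:M).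

Lemma blk_mul p i (X : 'M[K]_(N, p)) : blk i *m X = submxcol X i.
Proof.
rewrite -{1}[X]submxcolK mul_mxrow_mxcol (bigD1 i) //= eqxx mul1mx big1 ?addr0 //.
by move=> j; rewrite eq_sym => /negPf ->; rewrite mul_scalar_mx scale0r.
Qed.

Lemma tr_blk i : (blk i)^T = \mxcol_(j < m) ((i == j)%:R%:M : 'M[K]_n).
Proof. by rewrite tr_mxrow; apply: eq_mxcol => j; rewrite tr_scalar_mx. Qed.

Lemma mul_tr_blk p i (X : 'M[K]_(p, N)) : X *m (blk i)^T = submxrow X i.
Proof. by apply: trmx_inj; rewrite trmx_mul trmxK blk_mul tr_submxrow. Qed.

Lemma blk_orth i j : blk i *m (blk j)^T = (i == j)%:R%:M.
Proof. by rewrite blk_mul tr_blk mxcolK eq_sym. Qed.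

Lemma blk_total : \sum_i (blk i)^T *m blk i = 1%:M.
Proof.
apply/eqP; rewrite -subr_eq0; apply/eqP.
rewrite -[LHS]submxcolK -[RHS](mxcol0 (p_ := fun _ : 'I_m => n)).
apply: eq_mxcol => i; rewrite -blk_mul mulmxBr mulmx1 mulmx_sumr [X in X - _](bigD1 i) //=.
rewrite mulmxA blk_orth eqxx mul1mx [X in _ + X - _]big1 ?addr0 ?subrr // => j.
by rewrite eq_sym mulmxA blk_orth => /negPf ->; rewrite mul_scalar_mx scale0r.
Qed.

End BlockProjections.

Section ErrorSystem.
Variables (K : fieldType) (n m : nat) (p q : 'I_m -> nat).
Variables (nb : 'I_m -> {set 'I_m}) (A : 'M[K]_n).
Variables (B : forall i, 'M[K]_(n, p i)) (C : forall i, 'M[K]_(q i, n)).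
Variable (F : forall i, 'M[K]_(p i, n)).
Local Notation N := (\sum_(i < m) n)%N.
Local Notation blk := (@blk K n m).

Definition open_loop : 'M[K]_N := \sum_i (blk i)^T *m
  (A *m blk i + \sum_j B j *m F j *m (blk i - blk j)).

(* The blocks of the differences [e_i - e_j] with non-neighbors [j] are zero. *)
Definition measurement i : 'M[K]_(q i + N, N) :=
  col_mx (C i *m blk i) (\mxcol_(j < m) ((j \in nb i)%:R *: (blk i - blk j))).

Lemma blk_open_loop i :
  blk i *m open_loop = A *m blk i + \sum_j B j *m F j *m (blk i - blk j).
Proof.
rewrite mulmx_sumr [LHS](bigD1 i) //= mulmxA blk_orth eqxx mul1mx.
rewrite [X in _ + X = _]big1 ?addr0 // => j.
by rewrite eq_sym mulmxA blk_orth => /negPf ->; rewrite mul_scalar_mx scale0r.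
Qed.

(** The terms [B_k F_k e_k] cancel, so differences evolve autonomously and agreement of two agents
    persists in open loop. *)
Lemma diff_open_loop i j :
  (blk i - blk j) *m open_loop = (A + \sum_k B k *m F k) *m (blk i - blk j).
Proof.
rewrite mulmxBl !blk_open_loop opprD addrACA -mulmxBr -sumrB mulmxDl mulmx_suml.
congr (_ + _); apply: eq_bigr => k _; rewrite -mulmxBr; congr (_ *m _).
by rewrite opprB addrA subrK.
Qed.

Lemma measurement_diff i j : j \in nb i -> (blk i - blk j <= measurement i)%MS.
Proof.
move=> ji; rewrite /measurement -addsmxE (submx_trans _ (addsmxSr _ _)) //.
have := sub_mxcol (fun j => (j \in nb i)%:R *: (blk i - blk j)) j.
by rewrite ji scale1r.
Qed.

Lemma measurement_output i : (C i *m blk i <= measurement i)%MS.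
Proof. by rewrite /measurement -addsmxE addsmxSl. Qed.

(** Splitting [X] into its part on the output and its blocks on the differences gives exactly the
    gains in the rows of the closed loop. *)
Lemma mul_measurement r i k (X : 'M[K]_(r, q i + N)) :
  X *m measurement i *m (blk k)^T =
  (k == i)%:R *: (lsubmx X *m C i + \sum_(j in nb i) submxrow (rsubmx X) j)
  - (k \in nb i)%:R *: submxrow (rsubmx X) k.
Proof.
have diffE j : (blk i - blk j) *m (blk k)^T = ((k == i)%:R - (k == j)%:R)%:M.
  by rewrite mulmxBl !blk_orth -raddfB /= ![_ == k]eq_sym.
rewrite -{1}[X]hsubmxK mul_row_col mulmxDl -[rsubmx X in X in _ + X]submxrowK.
rewrite mul_mxrow_mxcol mulmx_suml scalerDr -addrA; congr (_ + _).
  by rewrite -!mulmxA blk_orth eq_sym mul_mx_scalar -scalemxAr.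
rewrite scaler_sumr big_mkcond /=.
transitivity (\sum_j ((if j \in nb i then (k == i)%:R *: submxrow (rsubmx X) j else 0)
    - (if k == j then (j \in nb i)%:R *: submxrow (rsubmx X) j else 0))).
  apply: eq_bigr => j _; rewrite -scalemxAr -scalemxAl -mulmxA diffE mul_mx_scalar.
  case: (j \in nb i); rewrite ?scale1r ?scale0r ?if_same ?subrr //.
  by rewrite scalerBl; case: (k == j); rewrite ?scale1r ?scale0r.
rewrite sumrB; congr (_ - _).
  by rewrite -big_mkcond.
by rewrite -big_mkcond (eq_bigl (pred1 k)) ?big_pred1_eq // => j; rewrite eq_sym.
Qed.

End ErrorSystem.

Lemma map_krylov (K1 K2 : fieldType) (f : {rmorphism K1 -> K2}) r n k
    (c : 'M[K1]_(r, n)) (M : 'M[K1]_n) :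
  krylov k (map_mx f c) (map_mx f M) = map_mx f (krylov k c M).
Proof.
apply/matrixP => i j; rewrite [LHS]mxE [RHS]mxE -map_mxX -map_mxM.
by rewrite [LHS]mxE; congr (f _); rewrite [RHS]mxE.
Qed.

(** * Descent from complex to real parameters *)

Section ComplexParts.
Variable R : rcfType.
Local Notation iota := (real_complex R).
Local Notation re := (map_mx (@complex.Re R)).
Local Notation im := (map_mx (@complex.Im R)).

Lemma complex_mxE a b (X : 'M[R[i]]_(a, b)) :
  X = map_mx iota (re X) + 'i%C *: map_mx iota (im X).
Proof. by apply/matrixP => i j; rewrite !mxE -complexE. Qed.

Lemma re_mul_map a b c (X : 'M[R[i]]_(a, b)) (Y : 'M[R]_(b, c)) :
  re (X *m map_mx iota Y) = re X *m Y.
Proof.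
apply/matrixP => i j; rewrite !mxE; elim/big_rec2: _ => // k z t _ <-.
by rewrite !mxE; case: (X i k) t => x y [u v] /=; rewrite mulr0 subr0.
Qed.

Lemma im_mul_map a b c (X : 'M[R[i]]_(a, b)) (Y : 'M[R]_(b, c)) :
  im (X *m map_mx iota Y) = im X *m Y.
Proof.
apply/matrixP => i j; rewrite !mxE; elim/big_rec2: _ => // k z t _ <-.
by rewrite !mxE; case: (X i k) t => x y [u v] /=; rewrite mulr0 add0r.
Qed.

Lemma re_map_mul a b c (X : 'M[R]_(a, b)) (Y : 'M[R[i]]_(b, c)) :
  re (map_mx iota X *m Y) = X *m re Y.
Proof.
apply/matrixP => i j; rewrite !mxE; elim/big_rec2: _ => // k z t _ <-.
by rewrite !mxE; case: (Y k j) t => x y [u v] /=; rewrite mul0r subr0.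
Qed.

Lemma im_map_mul a b c (X : 'M[R]_(a, b)) (Y : 'M[R[i]]_(b, c)) :
  im (map_mx iota X *m Y) = X *m im Y.
Proof.
apply/matrixP => i j; rewrite !mxE; elim/big_rec2: _ => // k z t _ <-.
by rewrite !mxE; case: (Y k j) t => x y [u v] /=; rewrite mul0r addr0.
Qed.

(** Symmetry makes the product invariant under conjugation, so its coefficients are real. *)
Lemma real_root_poly (L : seq R[i]) : symmetric_spectrum L ->
  exists2 chi : {poly R}, chi \is monic /\ size chi = (size L).+1 &
    map_poly (fun x : R => (x%:C)%C) chi = \prod_(l <- L) ('X - l%:P).
Proof.
move=> symL; set P := \prod_(l <- L) _.
have PJ : map_poly (@conjc R) P = P.
  rewrite rmorph_prod /= -[RHS](perm_big _ symL) big_map; apply: eq_bigr => l _.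
  by rewrite rmorphB /= map_polyX map_polyC.
have Preal j : (complex.Re P`_j)%:C%C = P`_j.
  have : (P`_j)^*%C = P`_j by rewrite -[RHS](congr1 (fun p : {poly _} => p`_j) PJ) coef_map.
  by case: (P`_j) => x y [] yy; rewrite (_ : y = 0) //=; lra.
have chiE : map_poly iota (map_poly (@complex.Re R) P) = P.
  by apply/polyP => j; rewrite coef_map /= coef_map_id0 // Preal.
exists (map_poly (@complex.Re R) P) => //.
rewrite -(map_monic iota) -(size_map_poly iota) chiE; split.
  by apply: monic_prod => l _; apply: monicXsubC.
by rewrite size_prod_XsubC.
Qed.

(* An admissible complex choice of parameters has admissible real and imaginary
   parts, hence yields a line of admissible real choices; both rank conditions
   hold at ['i] on this line, hence also at some natural number. *)
Lemma real_specialization n m q N (E : 'I_m -> 'M[R]_(n, N)) (s : 'I_m -> nat)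
    (c : forall i, 'M[R]_(s i, N)) (A0 : 'M[R]_N)
    (M : 'M[R[i]]_N) (g : 'rV[R[i]]_(s q)) :
  admissible_for (fun i => map_mx iota (E i)) (fun i => map_mx iota (c i))
    (map_mx iota A0) M ->
  (N <= \rank (krylov N (g *m map_mx iota (c q)) M))%N ->
  (N <= \rank (krylov m (map_mx iota (E q)) M^T))%N ->
  exists (M' : 'M[R]_N) (g' : 'rV[R]_(s q)), [/\ admissible_for E c A0 M',
    (N <= \rank (krylov N (g' *m c q) M'))%N &
    (N <= \rank (krylov m (E q) M'^T))%N].
Proof.
move=> adm rg rE.
have [|d1 d1i d1P] := @krylov_generic R[i] _ _ N (map_mx iota (re g *m c q))
    (map_mx iota (im g *m c q)) (map_mx iota (re M)) (map_mx iota (im M)) N 'i%C.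
  by rewrite !map_mxM scalemxAl -mulmxDl -!complex_mxE.
have [|d2 d2i d2P] := @krylov_generic R[i] _ _ m (map_mx iota (E q)) 0
    (map_mx iota (re M)^T) (map_mx iota (im M)^T) N 'i%C.
  rewrite scaler0 addr0 [X in krylov _ _ X](_ : _ = M^T) //.
  by rewrite [M in RHS]complex_mxE; apply/matrixP => i j; rewrite !mxE.
have dd0 : d1 * d2 != 0.
  by rewrite mulf_neq0 //; apply/eqP => dE; [move: d1i|move: d2i]; rewrite dE root0.
have [j] := nat_nonroot dd0; rewrite rootM negb_or => /andP[/d1P r1 /d2P r2].
pose t : R := j%:R; have tE : j%:R = iota t by rewrite rmorph_nat.
exists (re M + t *: im M), (re g + t *: im g); split.
- move=> i; have /submxP[D] := adm i; rewrite mulmxBr => MD.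
  have /(congr1 (map_mx (@complex.Re R))) := MD.
  have /(congr1 (map_mx (@complex.Im R))) := MD.
  rewrite re_mul_map im_mul_map -map_mxM.
  have reB X Y : re (X - map_mx iota Y) = re X - Y :> 'M_(n, N).
    by apply/matrixP => a b; rewrite !mxE; case: (X a b).
  have imB X Y : im (X - map_mx iota Y) = im X :> 'M_(n, N).
    by apply/matrixP => a b; rewrite !mxE; case: (X a b) => x y /=; rewrite subr0.
  rewrite reB imB re_map_mul im_map_mul => imE reE.
  rewrite mulmxBr mulmxDr addrAC reE -scalemxAr imE scalemxAl -mulmxDl.
  exact: submxMl.
- move: r1; rewrite tE -!map_mxZ -!map_mxD map_krylov mxrank_map.
  by rewrite scalemxAl -mulmxDl.
- move: r2; rewrite tE scaler0 addr0 -!map_mxZ -!map_mxD map_krylov mxrank_map.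
  rewrite [X in krylov _ _ X](_ : _ = (re M + t *: im M)^T) //.
  by apply/matrixP => a b; rewrite !mxE.
Qed.

End ComplexParts.

Lemma strongly_connected_const m (nb : 'I_m -> {set 'I_m}) (T : Type) (f : 'I_m -> T) :
  strongly_connected nb -> (forall i j, j \in nb i -> f i = f j) ->
  forall i j, f i = f j.
Proof.
move=> conn fnb i j; have /connectP[s] := conn i j.
elim: s i => [|k s IH] i /= => [_ -> //|/andP[ik sk] jE].
by rewrite -(IH k sk jE) (fnb k i).
Qed.

(** * The error system as an admissible network *)

Section Assembly.
Variables (R : rcfType) (n m : nat) (p q : 'I_m -> nat) (A : 'M[R]_n).
Variables (B : forall i : 'I_m, 'M[R]_(n, p i)) (C : forall i : 'I_m, 'M[R]_(q i, n)).
Variables (nb : 'I_m -> {set 'I_m}) (F : forall i : 'I_m, 'M[R]_(p i, n)).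
Local Notation N := (\sum_(i < m) n)%N.
Local Notation iota := (real_complex R).
Local Notation cmap := (map_mx iota).
Local Notation blk := (@blk R n m).
Local Notation A0 := (open_loop A B F).
Local Notation meas := (measurement nb C).

Hypothesis obs : jointly_observable A C.
Hypothesis conn : strongly_connected nb.

Lemma cmap_diff i j : j \in nb i -> (cmap (blk i) - cmap (blk j) <= cmap (meas i))%MS.
Proof. by move=> ij; rewrite -map_mxB map_submx measurement_diff. Qed.

Lemma cmap_open_loop i j (x : 'cV[R[i]]_N) :
  cmap (blk i) *m x = cmap (blk j) *m x ->
  cmap (blk i) *m cmap A0 *m x = cmap (blk j) *m cmap A0 *m x.
Proof.
move=> xij; apply/eqP; rewrite -subr_eq0 -!mulmxBl -map_mxB -map_mxM diff_open_loop.
by rewrite map_mxM -mulmxA map_mxB mulmxBl xij subrr mulmx0.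
Qed.

(** Vanishing differences make all blocks of [x] equal by strong connectedness. The common block
    satisfies the eigenequation of [A] and is killed by every [C i], hence is zero. *)
Lemma joint_observability l (x : 'cV[R[i]]_N) :
  cmap A0 *m x = l *: x -> (forall i, cmap (meas i) *m x = 0) -> x = 0.
Proof.
move=> Ax mx.
have xE : forall i j, cmap (blk i) *m x = cmap (blk j) *m x.
  apply: strongly_connected_const conn _ => i j ij; apply/eqP.
  have /submxP[D DE] := cmap_diff ij.
  by rewrite -subr_eq0 -mulmxBl DE -mulmxA mx mulmx0.
have Cx i : cmap (C i) *m (cmap (blk i) *m x) = 0.
  have /submxP[D DE] := measurement_output nb C i.
  by rewrite mulmxA -map_mxM DE map_mxM -mulmxA mx mulmx0.
have Ae i : cmap A *m (cmap (blk i) *m x) = l *: (cmap (blk i) *m x).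
  rewrite scalemxAr -Ax [RHS]mulmxA -[X in _ = X *m _]map_mxM blk_open_loop.
  rewrite map_mxD mulmxDl map_mxM -mulmxA [X in _ = _ + X](_ : _ = 0) ?addr0 //.
  rewrite (raddf_sum (map_mx iota)) mulmx_suml big1 //= => j _.
  by rewrite map_mxM -mulmxA map_mxB mulmxBl (xE i j) subrr mulmx0.
have blkx i : cmap (blk i) *m x = 0.
  pose Call := \mxcol_i C i.
  have obsC : observes (cmap Call) (cmap A).
    apply: (@krylov_observes _ _ _ n); rewrite map_krylov mxrank_map.
    by rewrite (eqP obs).
  apply: (obsC l) => //.
  have -> : cmap Call = \mxcol_i cmap (C i) by apply/matrixP => a b; rewrite !mxE.
  by apply/mxcol_eq0P => j; rewrite (xE i j).
rewrite -[x]mul1mx -(map_mx1 iota) -blk_total (raddf_sum (map_mx iota)) mulmx_suml.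
by rewrite [LHS]big1 //= => i _; rewrite map_mxM -mulmxA blkx mulmx0.
Qed.

Lemma controlled_observed_network (k : 'I_m) :
  exists (M : 'M[R]_N) (g : 'rV[R]_(q k + N)), [/\ admissible_for blk meas A0 M,
    (N <= \rank (krylov N (g *m meas k) M))%N &
    (N <= \rank (krylov m (blk k) M^T))%N].
Proof.
have orth i j : cmap (blk i) *m (cmap (blk j))^T = (i == j)%:R%:M.
  rewrite map_trmx -map_mxM blk_orth map_scalar_mx /=.
  by case: (i == j); rewrite ?rmorph1 ?rmorph0.
have total : \sum_i (cmap (blk i))^T *m cmap (blk i) = 1%:M.
  rewrite -(map_mx1 iota) -blk_total (raddf_sum (map_mx iota)); apply: eq_bigr => i _.
  by rewrite map_trmx -map_mxM.
have [M [g [adm rg rE]]] := single_output_leader orth total cmap_diff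
  cmap_open_loop joint_observability conn k.
exact: real_specialization adm rg rE.
Qed.

(** The gains of agent [i] are the parts of a solution [D i] of
    [D i *m meas i = blk i *m (M - A0)]. *)
Lemma network_matrix_realization (M : 'M[R]_N) :
  admissible_for blk meas A0 M ->
  exists (K : forall i, 'M[R]_(n, q i)) (H : 'I_m -> 'I_m -> 'M[R]_n),
    @mxblock R m m (fun _ => n) (fun _ => n)
      (fun i k => ee_block nb A B C F K H i k) = M.
Proof.
move=> adm; pose D i := (blk i *m (M - A0)) *m pinvmx (meas i).
have DE i : blk i *m M = blk i *m A0 + D i *m meas i.
  by rewrite /D mulmxKpV // mulmxBr addrC subrK.
exists (fun i => lsubmx (D i)), (fun i j => submxrow (rsubmx (D i)) j).
rewrite -[RHS]submxblockK; apply: eq_mxblock => i k.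
rewrite submxblockEh -mul_tr_blk -blk_mul mulmxA DE mulmxDl mul_measurement.
rewrite blk_open_loop mulmxDl -mulmxA blk_orth mulmx_suml.
rewrite (eq_bigr (fun j => (i == k)%:R *: (B j *m F j)
    - (j == k)%:R *: (B j *m F j))); last first.
  move=> j _; rewrite -mulmxA mulmxBl !blk_orth -raddfB mul_mx_scalar /=.
  by rewrite scalerBl.
have BFE : \sum_j (j == k)%:R *: (B j *m F j) = B k *m F k.
  rewrite (bigD1 k) //= eqxx scale1r big1 ?addr0 // => j /negPf ->.
  by rewrite scale0r.
rewrite sumrB -scaler_sumr BFE mul_mx_scalar /ee_block [k == i]eq_sym.
by rewrite !scalerDr !addrA [RHS](ACl (1*4*5*2*6*3)).
Qed.

Lemma compensator_row_realization (k : 'I_m) (X : 'M[R]_(m.-1, q k + N)) :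
  @mxrow R m (fun _ => n) m.-1
    (fun j => ze_block nb C (lsubmx X) (fun j => submxrow (rsubmx X) j) j)
  = X *m meas k.
Proof.
rewrite -[RHS]submxrowK; apply: eq_mxrow => j.
by rewrite -mul_tr_blk mul_measurement.
Qed.

Lemma compensator_col_realization (k : 'I_m) (X : 'M[R]_(n, m.-1)) :
  @mxcol R m (fun _ => n) m.-1 (fun i => (i == k)%:R *: X) = (blk k)^T *m X.
Proof.
rewrite tr_blk mxcol_mul; apply: eq_mxcol => j.
by rewrite mul_scalar_mx eq_sym.
Qed.

End Assembly.

Unset Implicit Arguments. Set Strict Implicit.

Theorem theorem1 (R : realType) (n m : nat) (p q : 'I_m -> nat)
  (A : 'M[R]_n) (B : forall i : 'I_m, 'M[R]_(n, p i))
  (C : forall i : 'I_m, 'M[R]_(q i, n)) (N : 'I_m -> {set 'I_m})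
  (F : forall i : 'I_m, 'M[R]_(p i, n)) (qq : 'I_m) (L : seq R[i]) :
  jointly_controllable A B ->
  jointly_observable A C ->
  (forall i, B i != 0) ->
  (forall i, C i != 0) ->
  (forall i, i \in N i) ->
  strongly_connected N ->
  size L = (m * n + m.-1)%N ->
  symmetric_spectrum L ->
  exists (K : forall i : 'I_m, 'M[R]_(n, q i)) (H : 'I_m -> 'I_m -> 'M[R]_n)
         (Abar : 'M[R]_(m.-1)) (Cbar : 'M[R]_(n, m.-1))
         (Kbar : 'M[R]_(m.-1, q qq)) (Hbar : 'I_m -> 'M[R]_(m.-1, n)),
    spectrum_is (closed_loop_matrix N A B C F K H Abar Cbar Kbar Hbar) L.
Proof.
move=> _ obs _ _ _ conn sizeL symL.
have [chi [chi_monic chi_size] chiL] := real_root_poly symL.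
have [M [g [adm rg rE]]] := controlled_observed_network B F obs conn qq.
have m_gt0 : (0 < m)%N by apply: leq_ltn_trans (ltn_ord qq).
(* Agent [qq] spans in [m] steps, one more than the compensator order [m.-1]. *)
have [||D [Cbar [Kz [Abar charE]]]] := compensator_placement (b := (blk R n qq)^T)
  (mu := m.-1) (chi := chi) rg _ chi_monic.
- by rewrite trmxK prednK.
- by rewrite chi_size sizeL sum_nat_const card_ord.
(* The direct gain [D] of the compensator is a static feedback at [qq], so it is absorbed into [K]
   and [H]. *)
have adm' : admissible_for (@blk R n m) (measurement N C) (open_loop A B F)
    (M + (blk R n qq)^T *m D *m (g *m measurement N C qq)).
  rewrite mulmxA -[_ *m D *m g]mulmxA.
  apply: admissible_feedback adm; exact: blk_orth.
have [K [H KH]] := network_matrix_realization adm'.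
exists K, H, Abar, Cbar, (lsubmx (Kz *m g)), (fun j => submxrow (rsubmx (Kz *m g)) j).
rewrite /spectrum_is -chiL -charE /closed_loop_matrix KH.
by rewrite compensator_row_realization compensator_col_realization -(mulmxA Kz).
Qed.
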